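(* Let $n=1$ and $s\in(0,1)$. For every $k\in\mathbb{N}$, there exist a function $f_k\in C^k\left(\left[0,\frac12\right]\right)$ and a solution $u_k\in L^\infty(\mathbb{R})\cap C^0(\mathbb{R})\cap C^\infty((0,1))$ of $$ \begin{cases} -u_k''+(-\Delta)^su_k=f_k & \text{in }\left(0,\frac12\right),\\ u_k=0 & \text{in }(-\infty,0], \end{cases} $$ such that $$ u_k\in\begin{cases} C^{2,1-2s}\left(\left[0,\frac12\right]\right)\setminus\bigcup_{\varepsilon>0}C^{2,1-2s+\varepsilon}\left(\left[0,\frac12\right]\right) & \text{if } s\in\left(0,\frac12\right),\\ \bigcap_{\varepsilon>0}C^{1,1-\varepsilon}\left(\left[0,\frac12\right]\right)\setminus C^{1,1}\left(\left[0,\frac12\right]\right) & \text{if } s=\frac12,\\ C^{1,2-2s}\left(\left[0,\frac12\right]\right)\setminus\bigcup_{\varepsilon>0}C^{1,2-2s+\varepsilon}\left(\left[0,\frac12\right]\right) & \text{if } s\in\left(\frac12,1\right). \end{cases} $$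
   Context: Here $\mathbb{N}=\{1,2,\dots\}$ and $(-\Delta)^s$ is the one-dimensional fractional Laplacian $$(-\Delta)^su(x):=C_s\,\mathrm{p.v.}\int_{\mathbb{R}}\frac{u(x)-u(y)}{|x-y|^{1+2s}}\,dy,\qquad C_s=\frac{2^{2s}\,\Gamma\left(\frac{1+2s}{2}\right)}{\sqrt\pi\,\Gamma(2-s)}\,s(1-s),$$ where $\Gamma$ is Euler's Gamma function. $C^{m,\gamma}([0,\frac12])$ is the usual Hölder space of functions whose $m$-th derivative is $\gamma$-Hölder continuous up to the boundary; in the unions and intersections $\varepsilon$ ranges over the positive numbers for which the resulting Hölder exponent lies in $(0,1]$. *)

(* Defs.v *)
From HB Require Import structures.
From mathcomp Require Import all_boot all_order all_algebra.
From mathcomp Require Import all_classical all_reals all_analysis.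

Set Implicit Arguments.
Unset Strict Implicit.
Unset Printing Implicit Defensive.

Import Order.TTheory GRing.Theory Num.Theory.
Import numFieldNormedType.Exports.

Local Open Scope classical_set_scope.
Local Open Scope ring_scope.

Section fractional_laplacian.
Context {R : realType}.
Implicit Types (s x z : R) (u : R -> R).

(* Euler's integral; it converges for [0 < z]. *)
Definition Gamma z : R :=
  \int[lebesgue_measure]_(t in `]0, +oo[) (t `^ (z - 1) * expR (- t)).

Definition fraclap_const s : R :=
  2 `^ (2 * s) * Gamma ((1 + 2 * s) / 2) / (Num.sqrt pi * Gamma (2 - s))
  * (s * (1 - s)).

Definition fraclap_trunc s u x (r : R) : R :=
  \int[lebesgue_measure]_(y in [set y | r < `|x - y|])
    ((u x - u y) / `|x - y| `^ (1 + 2 * s)).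

(* [lim] is total: [fraclap s u x] is meaningful only when [fraclap_defined]. *)
Definition fraclap_defined s u x : Prop :=
  cvg (fraclap_trunc s u x r @[r --> 0^'+]).

Definition fraclap s u x : R :=
  fraclap_const s * lim (fraclap_trunc s u x r @[r --> 0^'+]).

End fractional_laplacian.

Section regularity.
Context {R : realType}.
Implicit Types (a b : R) (m : nat) (f g : R -> R).

(* [g] is the continuous extension to [a, b] of the [m]-th derivative of [f] on
   ]a, b[.  Only interior derivatives of [f] are involved, so the values of [f]
   outside [a, b] are irrelevant. *)
Definition derivative_up_to_boundary a b m f g : Prop :=
  {within `[a, b], continuous g} /\ {in `]a, b[, g =1 f^`(m)%classic}.

Definition Cm_closed a b m : set (R -> R) :=
  [set f | [/\ {within `[a, b], continuous f},
     forall j x, (j < m)%N -> x \in `]a, b[ -> derivable f^`(j)%classic x 1 &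
     forall j, (j <= m)%N -> exists g, derivative_up_to_boundary a b j f g]].

Definition holder_closed a b m (gamma : R) : set (R -> R) :=
  [set f | Cm_closed a b m f /\
     exists g, derivative_up_to_boundary a b m f g /\
     exists M : R, {in `[a, b] &, forall x y,
       `|g x - g y| <= M * `|x - y| `^ gamma}].

Definition Cinfty_open a b : set (R -> R) :=
  [set f | forall j x, x \in `]a, b[ -> derivable f^`(j)%classic x 1].

End regularity.

(* Main.v *)
Require Import Defs.
From HB Require Import structures.
From mathcomp Require Import all_boot all_order all_algebra.
From mathcomp Require Import all_classical all_reals all_analysis.
From mathcomp Require Import measurable_realfun ring lra.

(* Put [u = w o clamp] with [w x = x + sum_i x^p_i Q_i(ln x)] on [0, 1], so that
   [u = 0] on the left half-line and [u = w 1] for [x >= 1].  The fractional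
   Laplacian of [x^p Q(ln x)], continued in this way, is homogeneous up to an
   explicit smooth term coming from the corner at [1]: it solves an Euler equation
   [x F' = (p - 2 s) F + ...], hence equals [x^(p - 2 s) Q'(ln x)] up to a
   polynomial and a remainder vanishing to high order at [0], together with its
   derivatives.  The logarithms come from the resonances [p - 2 s \in nat].
   Starting from [x], whose fractional Laplacian has the singular part
   [c x^(1 - 2 s)] with [c != 0] (or [c ln x] if [s = 1/2]), one removes the singular
   part of [- u'' + (-Delta)^s u] by adding a second primitive of it; each such
   correction gains [2 - 2 s] in the exponent, so finitely many of them give
   [f \in C^k].  The first one, of order [x^(3 - 2 s)], fixes the exact regularity
   of [u] at [0]. *)

(** The Euler equation is the infinitesimal form of scaling: [x d/dx] commutes with the fractional
    Laplacian up to an added [2 s], and it sends [x^p Q(ln x)] to [p x^p Q(ln x) + x^p Q'(ln x)].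
    The jump of the slope at [1] contributes a multiple of [(1 - x)^(- 2 s)], which is smooth on
    [0, 1/2]. Expansions at [0] thus come from an induction on the degree of [Q] and from linear
    equations of order one, without any asymptotic analysis of integrals. No coefficient has to be
    computed except that of the linear start. It must be nonzero, and so must the normalizing
    constant: a regular [f] forces [u''] to contain [x^(1 - 2 s)] (or [ln x]), hence [u] to contain
    [x^(3 - 2 s)] (or [x^2 ln x]). All later corrections have exponents at least [5 - 4 s > 3 - 2 s]
    and cannot cancel this term. Principal values are encoded by two primitives of the integrand,
    one on each side of the singularity, with matched constants. This encoding is linear and scales
    well; Lebesgue integrals enter only afterwards, through the fundamental theorem of calculus. *)

Import Order.TTheory GRing.Theory Num.Theory.
Import numFieldNormedType.Exports.

Local Open Scope classical_set_scope.
Local Open Scope ring_scope.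

(** * Calculus on the half-line *)

Section calculus.
Context {R : realType}.
Set Implicit Arguments.
Unset Strict Implicit.
Unset Printing Implicit Defensive.
Implicit Types (f g D : R -> R) (a b c x y M : R).

(* A plain [Prop] wrapper: [is_derive] is a class, whose instances would be
   inferred eagerly during [apply]. *)
Definition D1 f x (d : R) : Prop := is_derive x (1 : R) f d.

Lemma D1_eq f x d d' : D1 f x d -> d = d' -> D1 f x d'.
Proof. by move=> h <-. Qed.

Lemma D1_cst c x : D1 (fun=> c) x 0.
Proof. exact: is_derive_cst. Qed.

Lemma D1_id x : D1 (fun y => y) x 1.
Proof. exact: is_derive_id. Qed.

Lemma D1_add f g x d e : D1 f x d -> D1 g x e -> D1 (fun y => f y + g y) x (d + e).
Proof. by move=> h1 h2; exact: is_deriveD. Qed.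

Lemma D1_opp f x d : D1 f x d -> D1 (fun y => - f y) x (- d).
Proof. by move=> h1; exact: is_deriveN. Qed.

Lemma D1_sub f g x d e : D1 f x d -> D1 g x e -> D1 (fun y => f y - g y) x (d - e).
Proof. by move=> h1 h2; exact: is_deriveB. Qed.

Lemma D1_mul f g x d e :
  D1 f x d -> D1 g x e -> D1 (fun y => f y * g y) x (d * g x + f x * e).
Proof.
move=> h1 h2; have h := is_deriveM h1 h2.
by apply: D1_eq h _; rewrite addrC /GRing.scale /= [g x * _]mulrC.
Qed.

Lemma D1_scale c f x d : D1 f x d -> D1 (fun y => c * f y) x (c * d).
Proof. by move=> h; exact: is_deriveZ. Qed.

Lemma D1_comp f g x d e :
  D1 f (g x) d -> D1 g x e -> D1 (fun y => f (g y)) x (d * e).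
Proof. exact: is_derive1_comp. Qed.

Lemma D1_pow a x : 0 < x -> D1 (fun y => y `^ a) x (a * x `^ (a - 1)).
Proof. exact: is_derive1_powR. Qed.

Lemma D1_ln x : 0 < x -> D1 (@ln R) x x^-1.
Proof. exact: is_derive1_ln. Qed.

Lemma D1_sum n (F : nat -> R -> R) (dF : nat -> R) x :
  (forall i, (i < n)%N -> D1 (F i) x (dF i)) ->
  D1 (fun y => \sum_(i < n) F i y) x (\sum_(i < n) dF i).
Proof.
elim: n => [|n IH] h.
  rewrite big_ord0 (_ : (fun _ => _) = fun=> 0); first exact: D1_cst.
  by apply/funext => y; rewrite big_ord0.
rewrite big_ord_recr /=.
rewrite (_ : (fun _ => _) = fun y => (\sum_(i < n) F i y) + F n y).
  by apply: D1_add; [apply: IH => i ni; apply: h; exact: ltnW|exact: h].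
by apply/funext => y; rewrite big_ord_recr.
Qed.

Lemma D1_near f g x d : (\forall y \near x, f y = g y) -> D1 f x d -> D1 g x d.
Proof. exact: near_eq_is_derive. Qed.

Lemma near_lt x a : x < a -> \forall y \near x, y < a.
Proof. exact: lt_nbhsl. Qed.

Lemma near_gt x a : a < x -> \forall y \near x, a < y.
Proof. exact: lt_nbhsr. Qed.

Lemma near_oo x a b : a < x < b -> \forall y \near x, a < y < b.
Proof.
move=> /andP[ax xb]; near=> y; apply/andP; split.
  by near: y; exact: near_gt.
by near: y; exact: near_lt.
Unshelve. all: by end_near. Qed.

Lemma D1_on a b f g x d : (forall y, a < y < b -> f y = g y) -> a < x < b ->
  D1 f x d -> D1 g x d.
Proof.
move=> fg xab; apply: D1_near; near=> y; apply: fg.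
by near: y; exact: near_oo.
Unshelve. all: by end_near. Qed.

Lemma D1_cont f x d : D1 f x d -> f y @[y --> x] --> f x.
Proof. by move=> [/derivable1_diffP/differentiable_continuous]. Qed.

Lemma cont_on a b f g x : (forall y, a < y < b -> f y = g y) -> a < x < b ->
  f y @[y --> x] --> f x -> g y @[y --> x] --> g x.
Proof.
move=> fg xab h; rewrite -fg //; apply: cvg_trans h; apply: near_eq_cvg.
by near=> y; apply: fg; near: y; exact: near_oo.
Unshelve. all: by end_near. Qed.

Lemma D1_within a b f df : (forall x, a <= x <= b -> D1 f x (df x)) ->
  {within `[a, b], continuous f}.
Proof.
move=> h; apply: derivable_within_continuous => x; rewrite in_itv /= => /h.
by case.
Qed.

Lemma le_D1_ge0 f df x y : x <= y -> (forall z, x <= z <= y -> D1 f z (df z)) ->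
  (forall z, x < z < y -> 0 <= df z) -> f x <= f y.
Proof.
rewrite le_eqVlt => /predU1P[->//|xy] h1 h2.
have hz z : z \in `]x, y[ -> D1 f z (df z).
  by rewrite in_itv /= => /andP[/ltW zx /ltW zy]; apply: h1; rewrite zx.
have [c cxy e] := MVT xy hz (D1_within h1).
rewrite -subr_ge0 e mulr_ge0 // ?subr_ge0 ?(ltW xy) //.
by apply: h2; move: cxy; rewrite in_itv.
Qed.

Lemma D1_0_cst a b f : (forall x, a < x < b -> D1 f x 0) ->
  forall x y, a < x < b -> a < y < b -> f x = f y.
Proof.
move=> h x y.
wlog xy : x y / x <= y.
  by move=> H hx hy; case/orP: (le_total x y) => k; [|apply/esym]; exact: H.
move=> /andP[ax xb] /andP[ay yb].
have hz z : x <= z <= y -> a < z < b.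
  by move=> /andP[xz zy]; rewrite (lt_le_trans ax xz) (le_lt_trans zy yb).
apply/eqP; rewrite eq_le; apply/andP; split.
  by apply: (@le_D1_ge0 f (fun=> 0)) => // z /hz; exact: h.
rewrite -lerN2; apply: (@le_D1_ge0 (fun z => - f z) (fun=> 0)) => // z /hz/h k.
by rewrite -oppr0; exact: D1_opp.
Qed.

Lemma pow_split x a b : 0 < x -> x `^ (a + b) = x `^ a * x `^ b.
Proof. by move=> x0; rewrite powRD // (gt_eqF x0) implybT. Qed.

Lemma pow_1 x : 0 < x -> x `^ 1 = x.
Proof. by move=> x0; rewrite powRr1 // ltW. Qed.

Lemma D1_powscale M b x : b != 0 -> 0 < x ->
  D1 (fun z => M / b * z `^ b) x (M * x `^ (b - 1)).
Proof.
move=> b0 x0; apply: D1_eq; first by apply: D1_scale; exact: D1_pow.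
by rewrite mulrA divfK.
Qed.

(** Both [M / b * y^b + D y] and [M / b * y^b - D y] have a nonnegative derivative, so no integral
    of [dD] is needed. *)
Lemma D1_bound_diff D dD c M b : 0 < b -> (forall x, 0 < x < c -> D1 D x (dD x)) ->
  (forall x, 0 < x < c -> `|dD x| <= M * x `^ (b - 1)) ->
  forall x y, 0 < x -> x <= y -> y < c ->
  `|D y - D x| <= M / b * (y `^ b - x `^ b).
Proof.
move=> b0 h1 h2 x y x0 xy yc.
have hz z : x <= z <= y -> 0 < z < c.
  by move=> /andP[xz zy]; rewrite (lt_le_trans x0 xz) (le_lt_trans zy yc).
have hz' z : x < z < y -> 0 < z < c.
  by move=> /andP[xz zy]; apply: hz; rewrite !ltW.
rewrite ler_norml; apply/andP; split.
  suff : M / b * x `^ b + D x <= M / b * y `^ b + D y by lra.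
  apply: (@le_D1_ge0 (fun z => M / b * z `^ b + D z)
    (fun z => M * z `^ (b - 1) + dD z)) => // z => [/hz|/hz'] zc.
    by apply: D1_add (h1 _ zc); apply: D1_powscale; [rewrite gt_eqF|case/andP: zc].
  by have := h2 _ zc; rewrite ler_norml => /andP[? ?]; lra.
suff : M / b * x `^ b - D x <= M / b * y `^ b - D y by lra.
apply: (@le_D1_ge0 (fun z => M / b * z `^ b - D z)
  (fun z => M * z `^ (b - 1) - dD z)) => // z => [/hz|/hz'] zc.
  by apply: D1_sub (h1 _ zc); apply: D1_powscale; [rewrite gt_eqF|case/andP: zc].
by have := h2 _ zc; rewrite ler_norml => /andP[? ?]; lra.
Qed.

Lemma near0 c : 0 < c -> \forall x \near 0^'+, 0 < x < c.
Proof.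
move=> c0; near=> x; apply/andP; split; near: x; first exact: nbhs_right_gt.
exact: nbhs_right_lt.
Unshelve. all: by end_near. Qed.

(** Adding [M / b * x^b] makes [D] nondecreasing and keeps it bounded below near [0], so a right
    limit exists; the added term vanishes in the limit because [0 < b]. This is how integration from
    [0] is expressed below: take any primitive and subtract its limit [l]. *)
Lemma D1_bound_lim D dD c M b : 0 < b -> 0 < c ->
  (forall x, 0 < x < c -> D1 D x (dD x)) ->
  (forall x, 0 < x < c -> `|dD x| <= M * x `^ (b - 1)) ->
  exists l, D x @[x --> 0^'+] --> l /\
    forall x, 0 < x < c -> `|D x - l| <= M / b * x `^ b.
Proof.
move=> b0 c0 h1 h2; have hd := D1_bound_diff b0 h1 h2.
pose y0 := c / 2; have y0c : 0 < y0 < c by rewrite /y0; lra.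
have [y00 y0c'] := andP y0c.
have M0 : 0 <= M.
  have := le_trans (normr_ge0 _) (h2 _ y0c).
  by rewrite pmulr_lge0 // powR_gt0.
pose E x := D x + M / b * x `^ b.
have ndE x y : 0 < x -> x <= y -> y < c -> E x <= E y.
  move=> x0 xy yc; have := hd _ _ x0 xy yc.
  by rewrite ler_norml /E => /andP[? ?]; lra.
have Mb0 : 0 <= M / b by rewrite divr_ge0 // ltW.
have lb : has_lbound (E @` [set` Interval (BRight 0) (BLeft c)]).
  exists (D y0 - M / b * y0 `^ b) => v [x /=]; rewrite in_itv /= => /andP[x0 xc] <-.
  have px : 0 <= M / b * x `^ b by rewrite mulr_ge0 // powR_ge0.
  have py : 0 <= M / b * y0 `^ b by rewrite mulr_ge0 // powR_ge0.
  case/orP: (le_total x y0) => xy.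
    by have := hd _ _ x0 xy y0c'; rewrite ler_norml /E => /andP[? ?]; lra.
  by have := ndE _ _ y00 xy xc; rewrite /E; lra.
have cE := @nondecreasing_at_right_cvgr R E 0 (BLeft c) _ _ lb.
have {}cE : E x @[x --> 0^'+] --> inf (E @` [set` Interval (BRight 0) (BLeft c)]).
  apply: cE; first by rewrite bnd_simp.
  move=> x y; rewrite !in_itv /= => /andP[x0 _] /andP[_ yc] xy; exact: ndE.
set l := inf _ in cE.
have cD : D x @[x --> 0^'+] --> l.
  have hp : M / b * x `^ b @[x --> 0^'+] --> M / b * 0.
    by apply: cvgMr; exact: powR_cvg0.
  have cE' : E x - M / b * x `^ b @[x --> 0^'+] --> l.
    have -> : l = l - M / b * 0 by rewrite mulr0 subr0.
    exact: cvgB.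
  apply: cvg_trans cE'.
  by apply: near_eq_cvg; near=> x; rewrite /E addrK.
exists l; split=> // y /andP[y0' yc].
have hn : `|D y - D x| @[x --> 0^'+] --> `|D y - l|.
  by apply: cvg_norm; apply: cvgB => //; exact: cvg_cst.
apply: (cvgr_to_le hn); near=> x.
have /andP[x0 xy] : 0 < x < y by near: x; exact: near0.
apply: le_trans (hd _ _ x0 (ltW xy) yc) _.
by rewrite ler_wpM2l // lerBlDr lerDl powR_ge0.
Unshelve. all: by end_near. Qed.

(* The case distinction in [F] stands for the oriented integral from [c] to [x]. *)
Lemma primitive_oo a b f : (forall x, a < x < b -> f y @[y --> x] --> f x) ->
  exists F : R -> R, forall x, a < x < b -> D1 F x (f x).
Proof.
move=> cf.
have [ab|ba] := ltP a b; last first.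
  exists (fun=> 0) => x /andP[ax xb].
  by move: (lt_trans ax xb); rewrite ltNge ba.
pose mu := @lebesgue_measure R.
pose c := (a + b) / 2; have [ac cb] : a < c /\ c < b by rewrite /c; lra.
have itg u v : a < u -> v < b -> mu.-integrable `[u, v] (EFin \o f).
  move=> au vb; apply: continuous_compact_integrable; first exact: segment_compact.
  apply: continuous_in_subspaceT => x; rewrite inE /= in_itv /= => /andP[ux xv].
  by apply: cf; rewrite (lt_le_trans au ux) (le_lt_trans xv vb).
pose F x := \int[mu]_(t in `]c, x]) f t - \int[mu]_(t in `]x, c]) f t.
exists F => x /andP[ax xb].
(* The segment [a', b'] lies inside []a, b[] and contains both [x] and [c] in its interior, so near
   [x] the oriented integral from [c] is [G y - G c], with a fixed lower endpoint. *)
pose a' := (a + Num.min x c) / 2.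
pose b' := (b + Num.max x c) / 2.
have aa' : a < a' by rewrite /a'; case: (leP x c) => _; lra.
have a'x : a' < x by rewrite /a'; case: (leP x c) => ?; lra.
have a'c : a' < c by rewrite /a'; case: (leP x c) => ?; lra.
have bb' : b' < b by rewrite /b'; case: (leP x c) => _; lra.
have xb' : x < b' by rewrite /b'; case: (leP x c) => ?; lra.
have cb' : c < b' by rewrite /b'; case: (leP x c) => ?; lra.
pose G y := \int[mu]_(t in `[a', y]) f t.
have FG y : a' < y < b' -> G y - G c = F y.
  move=> /andP[a'y yb']; rewrite /F.
  have [cy|yc] := leP c y.
    rewrite [\int[mu]_(t in `]y, c]) _](_ : _ = 0) ?subr0; last first.
      by rewrite set_itv_ge ?Rintegral_set0 // bnd_simp -leNgt.
    rewrite /G (@Rintegral_itvB _ f (BLeft a') (BRight y) c) //.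
    - by apply: itg => //; exact: lt_trans bb'.
    - by rewrite bnd_simp ltW.
  rewrite [\int[mu]_(t in `]c, y]) _](_ : _ = 0) ?sub0r; last first.
    by rewrite set_itv_ge ?Rintegral_set0 // bnd_simp -leNgt ltW.
  rewrite -(@Rintegral_itvB _ f (BLeft a') (BRight c) y) //.
  - by rewrite opprB.
  - by apply: itg => //; exact: lt_trans bb'.
  - by rewrite bnd_simp ltW.
  - by rewrite bnd_simp ltW.
apply: (@D1_on a' b' (fun y => G y - G c)) => //; first by rewrite a'x.
have cfx : {for x, continuous f} by apply: cf; rewrite ax.
have [dG eG] := continuous_FTC1_closed xb' (itg _ _ aa' bb') a'x cfx.
have DG : D1 G x (f x) by rewrite -eG derive1E; exact: derivableP.
by apply: D1_eq (D1_sub DG (D1_cst (G c) x)) _; rewrite subr0.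
Qed.

End calculus.

(** * Power-log functions and remainders at the origin *)

Section symbols.
Context {R : realType}.
Set Implicit Arguments.
Unset Strict Implicit.
Unset Printing Implicit Defensive.
Implicit Types (f g h r : R -> R) (a b c x y p M N e : R) (P Q : {poly R}).

Definition plog p Q x : R := x `^ p * Q.[ln x].

Lemma D1_horner Q x : D1 (fun y => Q.[y]) x Q^`().[x].
Proof. exact: is_derive_poly. Qed.

Lemma D1_poly_ln Q x : 0 < x -> D1 (fun y => Q.[ln y]) x (Q^`().[ln x] * x^-1).
Proof. by move=> x0; apply: (@D1_comp _ (horner Q)); [exact: D1_horner|exact: D1_ln]. Qed.

Lemma D1_plog p Q x : 0 < x ->
  D1 (plog p Q) x (plog (p - 1) (p *: Q + Q^`()) x).
Proof.
move=> x0; apply: D1_eq; first by apply: D1_mul; [exact: D1_pow|exact: D1_poly_ln].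
rewrite /plog hornerD hornerZ pow_split // powR_inv1 ?ltW //; ring.
Qed.

Lemma plogD p P Q x : plog p (P + Q) x = plog p P x + plog p Q x.
Proof. by rewrite /plog hornerD mulrDr. Qed.

Lemma plogZ p c Q x : plog p (c *: Q) x = c * plog p Q x.
Proof. by rewrite /plog hornerZ mulrCA. Qed.

Lemma plogM a p Q x : 0 < x -> x `^ a * plog p Q x = plog (a + p) Q x.
Proof. by move=> x0; rewrite /plog pow_split // mulrA. Qed.

(** The logarithm lies below the identity; apply this at [x^(- e)]. *)
Lemma norm_ln_le e x : 0 < e -> 0 < x < 1 -> `|ln x| <= e^-1 * x `^ (- e).
Proof.
move=> e0 /andP[x0 x1]; rewrite ler0_norm; last by apply: ln_le0; rewrite ltW.
rewrite ler_pdivlMl //.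
have := ln_sublinear (powR_gt0 (- e) x0); rewrite ln_powR; lra.
Qed.

Lemma pow_le1 x a b : 0 < x < 1 -> b <= a -> x `^ a <= x `^ b.
Proof. by move=> /andP[x0 x1] ba; apply: ger_powR => //; rewrite x0 ltW. Qed.

Lemma poly_ln_bound Q e : 0 < e ->
  exists M, 0 <= M /\ forall x, 0 < x < 1 -> `|Q.[ln x]| <= M * x `^ (- e).
Proof.
elim/poly_ind: Q e => [|Q c IH] e e0.
  by exists 0; split => // x _; rewrite horner0 normr0 mul0r.
(* Half of the exponent pays for one factor [ln x], the other half for the remaining polynomial. *)
have e20 : 0 < e / 2 by lra.
have [M [M0 hM]] := IH _ e20.
exists (M * (e / 2)^-1 + `|c|); split.
  by rewrite addr_ge0 // mulr_ge0 // invr_ge0 ltW.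
move=> x x01; rewrite hornerMXaddC (le_trans (ler_normD _ _)) // mulrDl.
have x0 : 0 < x by case/andP: x01.
apply: lerD.
  rewrite (_ : - e = - (e / 2) + - (e / 2)); last lra.
  rewrite pow_split // normrM mulrACA; apply: ler_pM => //; first exact: hM.
  exact: norm_ln_le.
by rewrite ler_peMr // -[leLHS](powRr0 x); apply: pow_le1 => //; lra.
Qed.

Lemma plog_bound p Q N : N < p ->
  exists M, 0 <= M /\ forall x, 0 < x < 1 -> `|plog p Q x| <= M * x `^ N.
Proof.
move=> Np; have [M [M0 h]] := @poly_ln_bound Q (p - N) ltac:(lra).
exists M; split => // x x01; rewrite /plog normrM ger0_norm ?powR_ge0 //.
have x0 : 0 < x by case/andP: x01.
rewrite (_ : N = p + - (p - N)); last lra.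
by rewrite pow_split // mulrCA ler_wpM2l ?powR_ge0 //; exact: h.
Qed.

Lemma poly_primitive Q : exists Q', Q'^`() = Q.
Proof.
exists (\poly_(i < (size Q).+1) (Q`_i.-1 / i%:R)).
apply/polyP => i; rewrite coef_deriv coef_poly ltnS /=.
case: ltnP => iQ; last by rewrite mul0rn nth_default.
by rewrite -[LHS]mulr_natr divfK // pnatr_eq0.
Qed.

(** The operator [a + d/dX] is invertible because [d/dX] is nilpotent on polynomials. By [D1_plog],
    solving this equation amounts to finding a primitive of [x^(a - 1) Q(ln x)] of the same kind. *)
Lemma plog_solve a Q : a != 0 -> exists Q', a *: Q' + Q'^`() = Q.
Proof.
move=> a0; move: {2}(size Q).+1 (ltnSn (size Q)) => n.
elim: n Q => // n IH Q; rewrite ltnS => sQ.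
have [->|Q0] := eqVneq Q 0; first by exists 0; rewrite deriv0 scaler0 addr0.
have [Q1 e1] := IH Q^`() (leq_trans (lt_size_deriv Q0) sQ).
exists (a^-1 *: (Q - Q1)).
rewrite derivZ derivB -e1 scalerA mulfV // scale1r addrK scalerA mulVf // scale1r.
by rewrite subrK.
Qed.

(* [r] and its derivatives up to order [K] satisfy [r^(j) = O(x^(N - j))] at [0];
   [r] lives on (0, 1) and only its germ at [0] is estimated. *)
Fixpoint symb (K : nat) N r : Prop :=
  [/\ exists M, forall x, 0 < x < 1 / 2 -> `|r x| <= M * x `^ N,
      forall x, 0 < x < 1 -> r y @[y --> x] --> r x &
      match K with
      | 0%N => True
      | K'.+1 => exists r', (forall x, 0 < x < 1 -> D1 r x (r' x)) /\ symb K' (N - 1) r'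
      end].

Lemma symb_bound K N r : symb K N r ->
  exists M, 0 <= M /\ forall x, 0 < x < 1 / 2 -> `|r x| <= M * x `^ N.
Proof.
case: K => [|K] [[M hM] _ _]; exists `|M|; split => // x /hM/le_trans; apply.
  by rewrite ler_wpM2r ?powR_ge0 // ler_norm.
by rewrite ler_wpM2r ?powR_ge0 // ler_norm.
Qed.

Lemma symb_cont K N r : symb K N r -> forall x, 0 < x < 1 -> r y @[y --> x] --> r x.
Proof. by case: K => [|K] []. Qed.

Lemma symb_lift K N r r' :
  (exists M, forall x, 0 < x < 1 / 2 -> `|r x| <= M * x `^ N) ->
  (forall x, 0 < x < 1 -> D1 r x (r' x)) -> symb K (N - 1) r' -> symb K.+1 N r.
Proof.
by move=> h1 h2 h3; split => // [x /h2/D1_cont|] //; exists r'.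
Qed.

Lemma symb_S K N r : symb K.+1 N r -> symb K N r.
Proof.
elim: K N r => [|K IH] N r [h1 h2 [r' [h3 h4]]] //.
by split=> //; exists r'; split=> //; exact: IH.
Qed.

Lemma symb_eq K N r r2 : (forall x, 0 < x < 1 -> r x = r2 x) ->
  symb K N r -> symb K N r2.
Proof.
move=> e; have half x : 0 < x < 1 / 2 -> 0 < x < 1.
  by move=> /andP[-> x2] /=; apply: lt_trans x2 _; lra.
case: K => [|K] [[M hM] h2 h3].
  split => //.
    by exists M => x xh; rewrite -e; [exact: hM|exact: half].
  by move=> x x01; apply: (cont_on e) => //; exact: h2.
have [r' [h4 h5]] := h3.
apply: (@symb_lift _ _ _ r') => //.
  by exists M => x xh; rewrite -e; [exact: hM|exact: half].
by move=> x x01; apply: (D1_on e) => //; exact: h4.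
Qed.


Lemma half_lt1 x : 0 < x < 1 / 2 -> 0 < x < 1.
Proof. by move=> /andP[-> x2] /=; apply: lt_trans x2 _; lra. Qed.

Lemma bound_le N N' r : N' <= N ->
  (exists M, forall x, 0 < x < 1 / 2 -> `|r x| <= M * x `^ N) ->
  exists M, forall x, 0 < x < 1 / 2 -> `|r x| <= M * x `^ N'.
Proof.
move=> NN [M hM]; exists `|M| => x xh; apply: le_trans (hM _ xh) _.
apply: (@le_trans _ _ (`|M| * x `^ N)).
  by rewrite ler_wpM2r ?powR_ge0 // ler_norm.
by rewrite ler_wpM2l ?normr_ge0 // pow_le1 // half_lt1.
Qed.

Lemma symb_le K N N' r : N' <= N -> symb K N r -> symb K N' r.
Proof.
elim: K N N' r => [|K IH] N N' r NN [h1 h2 h3].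
  by split => //; exact: bound_le h1.
have [r' [h4 h5]] := h3; apply: (@symb_lift _ _ _ r') => //.
  exact: bound_le h1.
by apply: IH h5; lra.
Qed.

Lemma symb_add K N f g : symb K N f -> symb K N g -> symb K N (fun x => f x + g x).
Proof.
elim: K N f g => [|K IH] N f g [[M1 hM1] h2 h3] [[M2 hM2] k2 k3].
all: have hb : exists M, forall x, 0 < x < 1 / 2 -> `|f x + g x| <= M * x `^ N.
1,3: exists (M1 + M2) => x xh; rewrite (le_trans (ler_normD _ _)) // mulrDl;
     by apply: lerD; [exact: hM1|exact: hM2].
  by split => // x x01; apply: cvgD; [exact: h2|exact: k2].
have [r' [h4 h5]] := h3; have [t' [k4 k5]] := k3.
apply: (@symb_lift _ _ _ (fun x => r' x + t' x)) => //.
  by move=> x x01; apply: D1_add; [exact: h4|exact: k4].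
exact: IH.
Qed.

Lemma symb_cst0 K N : symb K N (fun=> 0).
Proof.
elim: K N => [|K IH] N.
  split => //.
    by exists 0 => x _; rewrite normr0 mul0r.
  by move=> x _; exact: cvg_cst.
apply: (@symb_lift _ _ _ (fun=> 0)) => //.
- by exists 0 => x _; rewrite normr0 mul0r.
- by move=> x _; exact: D1_cst.
Qed.

Lemma symb_scale K N c f : symb K N f -> symb K N (fun x => c * f x).
Proof.
elim: K N f => [|K IH] N f [[M hM] h2 h3].
all: have hb : exists M, forall x, 0 < x < 1 / 2 -> `|c * f x| <= M * x `^ N.
1,3: exists (`|c| * M) => x xh; rewrite normrM -mulrA ler_wpM2l //; exact: hM.
  by split => // x x01; apply: cvgM; [exact: cvg_cst|exact: h2].
have [r' [h4 h5]] := h3.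
apply: (@symb_lift _ _ _ (fun x => c * r' x)) => //.
  by move=> x x01; apply: D1_scale; exact: h4.
exact: IH.
Qed.

Lemma symb_powM K N a f : symb K N f -> symb K (N + a) (fun x => x `^ a * f x).
Proof.
elim: K N a f => [|K IH] N a f hf.
all: have [M [_ hM]] := symb_bound hf.
all: have hb : exists M, forall x, 0 < x < 1 / 2 -> `|x `^ a * f x| <= M * x `^ (N + a).
1,3: exists M => x xh; have x0 : 0 < x by (case/andP: xh).
1,2: rewrite (addrC N) pow_split // normrM ger0_norm ?powR_ge0 // mulrCA.
1,2: by rewrite ler_wpM2l ?powR_ge0 //; exact: hM.
  split => // x x01; apply: cvgM; last exact: (symb_cont hf).
  by apply: D1_cont; apply: D1_pow; case/andP: x01.
have [_ _ [r' [h4 h5]]] := hf.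
apply: (@symb_lift _ _ _ (fun x => a * x `^ (a - 1) * f x + x `^ a * r' x)) => //.
  move=> x x01; have x0 : 0 < x by case/andP: x01.
  by apply: D1_mul; [exact: D1_pow|exact: h4].
apply: symb_add.
  have : symb K (N + a - 1) (fun x => a * (x `^ (a - 1) * f x)).
    by apply: symb_scale; rewrite -addrA; apply: IH; exact: symb_S.
  by apply: symb_eq => x _; rewrite mulrA.
by have := IH _ a _ h5; rewrite addrAC.
Qed.

Lemma symb_plog K N p Q : N < p -> symb K N (plog p Q).
Proof.
elim: K N p Q => [|K IH] N p Q Np.
all: have hb : exists M, forall x, 0 < x < 1 / 2 -> `|plog p Q x| <= M * x `^ N.
1,3: by have [M [_ hM]] := plog_bound Q Np; exists M => x /half_lt1; exact: hM.
  by split => // x /andP[x0 _]; apply: D1_cont; exact: D1_plog.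
apply: (@symb_lift _ _ _ (plog (p - 1) (p *: Q + Q^`()))) => //.
  by move=> x /andP[x0 _]; exact: D1_plog.
by apply: IH; lra.
Qed.

(** Bootstrap: the equation expresses [g'] through [r] and [g], so a bound on [g] alone yields the
    bounds on its derivatives, one order at a time. *)
Lemma symb_euler K N a r g : symb K N r ->
  (forall x, 0 < x < 1 -> D1 g x (x `^ (-1) * (r x - a * g x))) ->
  (exists M, forall x, 0 < x < 1 / 2 -> `|g x| <= M * x `^ N) -> symb K N g.
Proof.
elim: K => [|K IH] hr hg hb.
  by split => // x /hg/D1_cont.
apply: (symb_lift hb hg).
apply: symb_powM; have hr' := symb_S hr.
have hg' : symb K N g by exact: IH.
have := symb_add hr' (symb_scale (- a) hg').
by apply: symb_eq => x _; rewrite mulNr.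
Qed.

(** Variation of constants: [g] is [x^(- a)] times the integral of [t^(a - 1) r] from [0] to [x].
    The integrand is [O(t^(N + a - 1))], which is where [0 < N + a] enters; starting the integral at
    [0] selects the solution of order [x^N]. *)
Lemma euler_solve K N a r : symb K N r -> 0 < N + a ->
  exists g, symb K N g /\
    forall x, 0 < x < 1 -> D1 g x (x `^ (-1) * (r x - a * g x)).
Proof.
move=> hr Na; have hra := symb_powM (a - 1) hr.
have [H hH] := primitive_oo (symb_cont hra).
have [M [M0 hM]] := symb_bound hra.
have [|||l [_ hl]] := @D1_bound_lim _ H (fun x => x `^ (a - 1) * r x) (1 / 2) M (N + a) Na.
- lra.
- by move=> x /half_lt1; exact: hH.
- by move=> x xh; rewrite -addrA; exact: hM.
pose g x := x `^ (- a) * (H x - l).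
have hg x : 0 < x < 1 -> D1 g x (x `^ (-1) * (r x - a * g x)).
  move=> x01; have x0 : 0 < x by case/andP: x01.
  apply: D1_eq.
    apply: D1_mul; first exact: D1_pow.
    by apply: D1_sub; [exact: hH|exact: D1_cst].
  rewrite /g subr0 mulrA -pow_split // (_ : - a + (a - 1) = -1); last lra.
  rewrite pow_split //; ring.
exists g; split => //; apply: (symb_euler hr hg).
exists (M / (N + a)) => x xh; have x0 : 0 < x by case/andP: xh.
rewrite /g normrM ger0_norm ?powR_ge0 //.
apply: (@le_trans _ _ (x `^ (- a) * (M / (N + a) * x `^ (N + a)))).
  by rewrite ler_wpM2l ?powR_ge0 //; exact: hl.
rewrite mulrCA -pow_split // ler_wpM2l //; last first.
  by rewrite le_eqVlt; apply/orP; left; apply/eqP; congr (_ `^ _); lra.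
by apply: divr_ge0 => //; exact: ltW.
Qed.

(** A substitute for smoothness up to [0] from the right. The polynomial is allowed to depend on the
    order requested. *)
Definition taylor f := forall K N, exists P r, symb K N r /\
  forall x, 0 < x < 1 -> f x = P.[x] + r x.

(** For [-1 < N] the primitive of [r] has a limit at [0]; this constant joins the polynomial, and
    what is left gains one order. *)
Lemma symb_primitive K N P r h : -1 < N -> symb K N r ->
  (forall x, 0 < x < 1 -> D1 h x (P.[x] + r x)) ->
  exists P' r', symb K.+1 (N + 1) r' /\ forall x, 0 < x < 1 -> h x = P'.[x] + r' x.
Proof.
move=> N1 hr hh; have [P1 e1] := poly_primitive P.
pose D x := h x - P1.[x].
have hD x : 0 < x < 1 -> D1 D x (r x).
  move=> x01; apply: D1_eq; first by apply: D1_sub; [exact: hh|exact: D1_horner].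
  by rewrite e1; ring.
have [M [_ hM]] := symb_bound hr.
have [||||l [_ hl]] := @D1_bound_lim _ D r (1 / 2) M (N + 1).
- lra.
- lra.
- by move=> x /half_lt1; exact: hD.
- by move=> x xh; rewrite addrK; exact: hM.
exists (P1 + l%:P), (fun x => D x - l); split.
  apply: (@symb_lift _ _ _ r); last by rewrite addrK.
    by exists (M / (N + 1)).
  move=> x x01; apply: D1_eq (D1_sub (hD _ x01) (D1_cst l x)) _.
  by rewrite subr0.
by move=> x x01; rewrite hornerD hornerC /D; ring.
Qed.

Lemma taylor_primitive f h : taylor f -> (forall x, 0 < x < 1 -> D1 h x (f x)) ->
  taylor h.
Proof.
move=> tf dh K N; have [P [r [hr e]]] := tf K (Num.max N 0).
have [||P' [r' [hr' e']]] := @symb_primitive K (Num.max N 0) P r h _ hr.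
- by rewrite lt_max; apply/orP; right; lra.
- by move=> x x01; rewrite -e //; exact: dh.
exists P', r'; split => //; apply: symb_S; apply: symb_le hr'.
have : N <= Num.max N 0 by rewrite le_max lexx.
lra.
Qed.

Lemma D1_onem_pow a x : x < 1 ->
  D1 (fun y => (1 - y) `^ a) x (- a * (1 - x) `^ (a - 1)).
Proof.
move=> x1; apply: D1_eq.
  apply: (@D1_comp _ (fun y => y `^ a) (fun y => 1 - y)).
    by apply: D1_pow; rewrite subr_gt0.
  by apply: D1_sub; [exact: D1_cst|exact: D1_id].
by ring.
Qed.

Lemma onem_pow_bound a : exists M, 0 <= M /\
  forall x, 0 < x < 1 / 2 -> (1 - x) `^ a <= M.
Proof.
exists (1 + (1 / 2) `^ a); split; first by rewrite addr_ge0 // powR_ge0.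
move=> x /andP[x0 xh]; have [a0|a0] := leP 0 a.
  apply: (@le_trans _ _ 1); last by rewrite lerDl powR_ge0.
  by rewrite -[leRHS](powRr0 (1 - x)); apply: pow_le1 => //; lra.
apply: (@le_trans _ _ ((1 / 2) `^ a)); last by rewrite lerDr.
have [b [b0 ->]] : exists b, 0 < b /\ a = - b by exists (- a); rewrite opprK oppr_gt0.
rewrite !powRN lef_pV2 ?posrE ?powR_gt0 //; try lra.
by apply: ge0_ler_powR; rewrite ?nnegrE //; lra.
Qed.

Lemma symb_onem K a N : N <= 0 -> symb K N (fun x => (1 - x) `^ a).
Proof.
elim: K a N => [|K IH] a N N0.
all: have hb : exists M, forall x, 0 < x < 1 / 2 -> `|(1 - x) `^ a| <= M * x `^ N.
1,3: have [M [M0 hM]] := onem_pow_bound a; exists M => x xh.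
1,2: rewrite ger0_norm ?powR_ge0 // (le_trans (hM _ xh)) // ler_peMr //.
1,2: by rewrite -(powRr0 x); apply: pow_le1 => //; exact: half_lt1.
  by split => // x /andP[_ x1]; exact: (D1_cont (@D1_onem_pow a x x1)).
apply: (@symb_lift _ _ _ (fun x => - a * (1 - x) `^ (a - 1))) => //.
  by move=> x /andP[_ x1]; exact: D1_onem_pow.
by apply: symb_scale; apply: IH; lra.
Qed.

Lemma taylor_onem a : taylor (fun x => (1 - x) `^ a).
Proof.
move=> K N.
suff [P [r [hr e]]] : exists P r, symb K (Num.trunc `|N|).+1%:R r /\
  forall x, 0 < x < 1 -> (1 - x) `^ a = P.[x] + r x.
  exists P, r; split => //; apply: symb_le hr.
  apply: le_trans (ler_norm N) _; apply: ltW.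
  by case/andP: (truncn_itv (normr_ge0 N)).
(* Differentiation turns the exponent [a] into [a - 1], so the induction runs over all [a] at once.
   It starts from mere boundedness near [0], and each integration gains one order. *)
elim: (Num.trunc _).+1 a => [|n IH] {}a.
  exists 0, (fun x => (1 - x) `^ a); split; first exact: symb_onem.
  by move=> x _; rewrite horner0 add0r.
have [P [r [hr e]]] := IH (a - 1).
have [|||P' [r' [hr' e']]] := @symb_primitive K n%:R ((- a) *: P)
   (fun x => - a * r x) (fun x => (1 - x) `^ a).
- by apply: (@lt_le_trans _ _ 0) => //; lra.
- exact: symb_scale.
- move=> x x01; apply: D1_eq; first by apply: D1_onem_pow; case/andP: x01.
  by rewrite e // hornerZ mulrDr.
exists P', r'; split => //; apply: symb_S.
by rewrite -[n.+1]addn1 natrD.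
Qed.

Lemma taylor_scale c f : taylor f -> taylor (fun x => c * f x).
Proof.
move=> tf K N; have [P [r [hr e]]] := tf K N.
exists (c *: P), (fun x => c * r x); split; first exact: symb_scale.
by move=> x x01; rewrite e // hornerZ mulrDr.
Qed.

Lemma taylor_ln_onem : taylor (fun x => ln (1 - x)).
Proof.
apply: (@taylor_primitive (fun x => -1 * (1 - x) `^ (-1))).
  by apply: taylor_scale; exact: taylor_onem.
move=> x /andP[_ x1]; apply: D1_eq.
  apply: (@D1_comp _ (@ln R) (fun y => 1 - y)).
    by apply: D1_ln; rewrite subr_gt0.
  by apply: D1_sub; [exact: D1_cst|exact: D1_id].
rewrite powR_inv1; last by rewrite subr_ge0 ltW.
by ring.
Qed.

End symbols.

(** * The singular integral of a power-log function *)

Section principal_value.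
Context {R : realType}.
Set Implicit Arguments.
Unset Strict Implicit.
Unset Printing Implicit Defensive.
Implicit Types (f g h w F : R -> R) (a b c x y z t r p M N e : R) (P Q : {poly R}).

Lemma bounded_segment a b f : a <= b ->
  (forall x, a <= x <= b -> f y @[y --> x] --> f x) ->
  exists M, forall x, a <= x <= b -> `|f x| <= M.
Proof.
move=> ab cf.
have [|c _ hc] := @EVT_max R (fun x => `|f x|) a b ab.
  apply: continuous_in_subspaceT => x; rewrite inE /= in_itv /= => xab.
  by apply: cvg_norm; exact: cf.
by exists `|f c| => x xab; apply: hc; rewrite in_itv.
Qed.

Lemma cvg_right_scale c f (l : R) : 0 < c -> f y @[y --> 0^'+] --> l ->
  f (y * c) @[y --> 0^'+] --> l.
Proof.
move=> c0; apply: (@cvg_comp _ _ _ (fun y : R => y * c) f).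
move=> A [e /= e0 hA]; exists (e / c); first by rewrite /= divr_gt0.
move=> y /=; rewrite sub0r normrN => hy y0; apply: hA => /=; last exact: mulr_gt0.
by rewrite sub0r normrN normrM (gtr0_norm c0) -ltr_pdivlMr.
Qed.

(** The principal value at [t = 1] exists because [phi (1 - r) + phi (1 + r)] is [O(r^2)]: [phi]
    vanishes at [1] and the first-order terms cancel. Against [r^(- a)] this is integrable exactly
    when [a < 3]. The free constants of the primitives are used to get [Am = 0] at [0] and matching
    values at [1]. *)
Lemma kernel_primitives (phi phi1 phi2 : R -> R) a : a < 3 -> phi 1 = 0 ->
  (forall t, 0 < t -> D1 phi t (phi1 t)) ->
  (forall t, 0 < t -> D1 phi1 t (phi2 t)) ->
  (forall t : R, 0 < t -> phi2 y @[y --> t] --> phi2 t) ->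
  (exists M, forall t, 0 < t < 1 / 2 -> `|phi t| <= M) ->
  exists Am Ap : R -> R,
  [/\ Am 0 = 0, Am y @[y --> 0^'+] --> 0,
      forall t, 0 < t < 1 -> D1 Am t (phi t * (1 - t) `^ (- a)),
      forall t, 1 < t -> D1 Ap t (phi t * (t - 1) `^ (- a)) &
      Am (1 - r) - Ap (1 + r) @[r --> 0^'+] --> 0].
Proof.
move=> a3 phi10 d1 d2 c2 [M hM].
have [A0 hA0] := @primitive_oo R 0 1 (fun t => phi t * (1 - t) `^ (- a)) ltac:(
  move=> t /andP[t0 t1]; apply: cvgM; [exact: D1_cont (d1 _ t0)|exact: D1_cont (D1_onem_pow _ t1)]).
have [M1 [M10 hM1]] := @onem_pow_bound R (- a).
have [||||l [hl _]] := @D1_bound_lim R A0 (fun t => phi t * (1 - t) `^ (- a)) (1 / 2) (M * M1) 1.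
- lra.
- lra.
- by move=> t /half_lt1; exact: hA0.
- move=> t th; rewrite subrr powRr0 mulr1 normrM [X in _ * X]ger0_norm ?powR_ge0 //.
  by apply: ler_pM; rewrite ?powR_ge0 //; [exact: hM|exact: hM1].
(* The value of [A0] at [0] is arbitrary, hence the value [0] is imposed there. *)
pose Am t := if t == 0 then 0 else A0 t - l.
have hAm t : 0 < t < 1 -> D1 Am t (phi t * (1 - t) `^ (- a)).
  move=> t01; apply: (@D1_on _ 0 1 (fun t => A0 t - l)) => //.
    by move=> y /andP[y0 _]; rewrite /Am gt_eqF.
  by apply: D1_eq (D1_sub (hA0 _ t01) (D1_cst l t)) _; rewrite subr0.
have cAm : Am y @[y --> 0^'+] --> 0.
  have h : A0 y - l @[y --> 0^'+] --> l - l by apply: cvgB => //; exact: cvg_cst.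
  rewrite subrr in h; apply: cvg_trans h; apply: near_eq_cvg; near=> y.
  by rewrite /Am gt_eqF.
have pinv t : 0 < t -> (t `^ (-1)) `^ (-1) = t.
  by move=> t0; rewrite -powRrM mulrN1 opprK pow_1.
(* Primitives are available on bounded intervals only; the inversion [t = 1 / z] brings []1, +oo[]
   to []0, 1[], and [fB] is the transformed integrand. *)
pose fB z := - (z `^ (- 2) * (phi (z `^ (-1)) * (z `^ (-1) - 1) `^ (- a))).
have cB z : 0 < z < 1 -> fB y @[y --> z] --> fB z.
  move=> /andP[z0 z1]; have hz : 0 < z `^ (-1) - 1.
    by rewrite subr_gt0 powR_inv1 ?ltW // invf_gt1.
  have dz := D1_pow (-1) z0.
  have dk := @D1_comp _ _ (fun y => y `^ (-1) - 1) _ _ _ (D1_pow (- a) hz)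
    (D1_sub dz (D1_cst 1 z)).
  have dl := @D1_comp _ _ (fun y => y `^ (-1)) _ _ _ (d1 _ (powR_gt0 _ z0)) dz.
  exact: D1_cont (D1_opp (D1_mul (D1_pow (- 2) z0) (D1_mul dl dk))).
have [B hB] := primitive_oo cB.
pose Bp t := B (t `^ (-1)).
have hBp t : 1 < t -> D1 Bp t (phi t * (t - 1) `^ (- a)).
  move=> t1; have t0 : 0 < t by apply: lt_trans t1.
  have ti : 0 < t `^ (-1) < 1.
    by rewrite powR_gt0 //= powR_inv1 ?ltW // invf_lt1.
  apply: D1_eq (@D1_comp _ _ (fun y => y `^ (-1)) _ _ _ (hB _ ti) (D1_pow _ t0)) _.
  rewrite /fB !pinv // -powRrM (_ : -1 * - 2 = 2); last ring.
  rewrite (_ : -1 - 1 = - 2 :> R); last ring.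
  rewrite (powRN t 2); have : t `^ 2 != 0 by rewrite gt_eqF // powR_gt0.
  move: (t `^ 2) => u u0; field => //.
have [M2 hM2] := @bounded_segment (1/2) (3/2) phi2 ltac:(lra) ltac:(
  move=> t /andP[t1 t2]; apply: c2; lra).
have c0 f t (d : R) : D1 f t d -> f (t - r) @[r --> 0^'+] --> f t.
  move=> h; have h' : D1 f (t - 0) d by rewrite subr0.
  have := D1_cont (@D1_comp _ f (fun r => t - r) 0 _ _ h' (D1_sub (D1_cst t 0) (D1_id 0))).
  by rewrite subr0 => /cvg_at_right_filter.
have c1 f t (d : R) : D1 f t d -> f (t + r) @[r --> 0^'+] --> f t.
  move=> h; have h' : D1 f (t + 0) d by rewrite addr0.
  have := D1_cont (@D1_comp _ f (fun r => t + r) 0 _ _ h' (D1_add (D1_cst t 0) (D1_id 0))).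
  by rewrite addr0 => /cvg_at_right_filter.
have dm f (d : R -> R) t : (forall t, 0 < t -> D1 f t (d t)) -> t < 1 ->
    D1 (fun r => f (1 - r)) t (- d (1 - t)).
  move=> h t1; apply: D1_eq (@D1_comp _ _ (fun r => 1 - r) _ _ _ (h (1 - t) _)
    (D1_sub (D1_cst 1 t) (D1_id t))) _.
    by rewrite subr_gt0.
  by rewrite sub0r mulrN1.
have dp f (d : R -> R) t : (forall t, 0 < t -> D1 f t (d t)) -> 0 < t ->
    D1 (fun r => f (1 + r)) t (d (1 + t)).
  move=> h t1; apply: D1_eq (@D1_comp _ _ (fun r => 1 + r) _ _ _ (h (1 + t) _)
    (D1_add (D1_cst 1 t) (D1_id t))) _.
    by rewrite addr_gt0.
  by rewrite add0r mulr1.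
(* [psi1] is the derivative of [psi]. Both tend to [0], so two integrations of the bound on [phi2]
   give [|psi r| <= M2 * r^2]. *)
pose psi1 r := phi1 (1 + r) - phi1 (1 - r).
pose psi r := phi (1 - r) + phi (1 + r).
have hpsi1 t : 0 < t < 1 / 2 -> D1 psi1 t (phi2 (1 + t) + phi2 (1 - t)).
  move=> /andP[t0 t1]; apply: D1_eq (D1_sub (dp _ _ _ d2 t0) (dm _ _ t d2 _)) _.
    by lra.
  by rewrite opprK.
have hpsi t : 0 < t < 1 / 2 -> D1 psi t (psi1 t).
  move=> /andP[t0 t1]; apply: D1_eq (D1_add (dm _ _ t d1 _) (dp _ _ _ d1 t0)) _.
    by lra.
  by rewrite addrC.
have lt01 : (0 < 1 :> R) by [].
have [|||l1 [hl1 hb1]] := @D1_bound_lim R psi1 _ (1 / 2) (2 * M2) 1 _ _ hpsi1.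
- lra.
- lra.
- move=> t /andP[t0 t1]; rewrite subrr powRr0 mulr1 (le_trans (ler_normD _ _)) //.
  by rewrite mulr_natl mulr2n; apply: lerD; apply: hM2; lra.
have l10 : l1 = 0.
  have h : psi1 x @[x --> 0^'+] --> phi1 1 - phi1 1.
    by apply: cvgB; [exact: c1 (d2 _ lt01)|exact: c0 (d2 _ lt01)].
  by rewrite subrr in h; exact: (cvg_unique _ hl1 h).
have [|||l2 [hl2 hb2]] := @D1_bound_lim R psi _ (1 / 2) (2 * M2) 2 _ _ hpsi.
- lra.
- lra.
- move=> t th; have := hb1 _ th; rewrite l10 subr0 divr1.
  by rewrite (_ : 2 - 1 = 1 :> R) //; lra.
have l20 : l2 = 0.
  have h : psi x @[x --> 0^'+] --> phi 1 + phi 1.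
    by apply: cvgD; [exact: c0 (d1 _ lt01)|exact: c1 (d1 _ lt01)].
  by rewrite phi10 addr0 in h; exact: (cvg_unique _ hl2 h).
have [||||l3 [hl3 _]] := @D1_bound_lim R (fun r => Am (1 - r) - Bp (1 + r))
  (fun r => - (psi r * r `^ (- a))) (1 / 2) M2 (3 - a).
- lra.
- lra.
- move=> t /andP[t0 t1].
  have e1 : 0 < 1 - t < 1 by lra.
  have e2 : 1 < 1 + t by lra.
  apply: D1_eq.
    apply: D1_sub.
      exact: @D1_comp _ _ (fun r => 1 - r) _ _ _ (hAm _ e1) (D1_sub (D1_cst 1 t) (D1_id t)).
    exact: @D1_comp _ _ (fun r => 1 + r) _ _ _ (hBp _ e2) (D1_add (D1_cst 1 t) (D1_id t)).
  rewrite (_ : 1 - (1 - t) = t); last ring.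
  rewrite (_ : 1 + t - 1 = t); last ring.
  by rewrite /psi; ring.
- move=> t th; have t0 : 0 < t by case/andP: th.
  have := hb2 _ th; rewrite l20 subr0 mulrAC (_ : 2 * M2 * _ / 2 = M2 * t `^ 2); last by field.
  move=> h; rewrite normrN normrM [X in _ * X]ger0_norm ?powR_ge0 //.
  rewrite (_ : 3 - a - 1 = 2 - a); last ring.
  by rewrite pow_split // mulrA ler_wpM2r ?powR_ge0.
(* The shift by [l3], the limit of [Am (1 - r) - Bp (1 + r)], makes the two sides match. *)
exists Am, (fun t => Bp t + l3); split => //.
- by rewrite /Am eqxx.
- by move=> t t1; apply: D1_eq (D1_add (hBp _ t1) (D1_cst l3 t)) _; rewrite addr0.
have h : Am (1 - r) - Bp (1 + r) - l3 @[r --> 0^'+] --> l3 - l3.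
  by apply: cvgB => //; exact: cvg_cst.
rewrite subrr in h; apply: cvg_trans h; apply: near_eq_cvg; near=> y.
by rewrite opprD addrA.
Unshelve. all: by end_near. Qed.

Lemma cvg_sum0 n (c : nat -> R) (f : nat -> R -> R) :
  (forall i, (i < n)%N -> f i y @[y --> 0^'+] --> 0) ->
  \sum_(i < n) c i * f i y @[y --> 0^'+] --> 0.
Proof.
elim: n => [|n IH] h.
  rewrite (_ : (fun _ => _) = fun=> 0); first exact: cvg_cst.
  by apply/funext => y; rewrite big_ord0.
have h1 : (\sum_(i < n) c i * f i y) + c n * f n y @[y --> 0^'+] --> 0 + c n * 0.
  by apply: cvgD; [apply: IH => i /ltnW; exact: h|apply: cvgMr; exact: h].
rewrite mulr0 addr0 in h1; apply: cvg_trans h1; apply: near_eq_cvg; near=> y.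
by rewrite big_ord_recr.
Unshelve. all: by end_near. Qed.

(* [Gm] and [Gp] are primitives of [y |-> (w x - w y) / |x - y| ^ (1 + 2 s)] on
   both sides of [x]; the last two summands of [F x] are the integrals over
   [y < 0] and [y > 1], where [w] is continued by [0] and by [w 1]. *)
Definition pv_fraclap (s : R) w F : Prop := forall x, 0 < x < 1 ->
  exists Gm Gp : R -> R,
  [/\ Gm 0 = 0 /\ Gm y @[y --> 0^'+] --> 0,
      forall y, 0 < y < x -> D1 Gm y ((w x - w y) * (x - y) `^ (- (1 + 2 * s))),
      forall y, x < y -> D1 Gp y ((w x - w y) * (y - x) `^ (- (1 + 2 * s))),
      Gm (x - r) - Gp (x + r) @[r --> 0^'+] --> 0 &
      F x = Gp 1 + w x * x `^ (- (2 * s)) / (2 * s)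
            + (w x - w 1) * (1 - x) `^ (- (2 * s)) / (2 * s)].

Lemma pv_fraclap_add s w1 w2 F1 F2 : pv_fraclap s w1 F1 -> pv_fraclap s w2 F2 ->
  pv_fraclap s (fun x => w1 x + w2 x) (fun x => F1 x + F2 x).
Proof.
move=> h1 h2 x x01; have [Gm [Gp [[g0 cg] dm dp cd e]]] := h1 x x01.
have [Hm [Hp [[k0 ck] dm' dp' cd' e']]] := h2 x x01.
exists (fun y => Gm y + Hm y), (fun y => Gp y + Hp y); split.
- split; first by rewrite g0 k0 addr0.
  by rewrite -[X in _ --> X](addr0 0); exact: cvgD.
- move=> y xy; apply: D1_eq (D1_add (dm _ xy) (dm' _ xy)) _; ring.
- move=> y xy; apply: D1_eq (D1_add (dp _ xy) (dp' _ xy)) _; ring.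
- have h : (Gm (x - r) - Gp (x + r)) + (Hm (x - r) - Hp (x + r)) @[r --> 0^'+] --> 0 + 0.
    exact: cvgD.
  rewrite addr0 in h; apply: cvg_trans h; apply: near_eq_cvg; near=> y.
  by ring.
- by rewrite e e'; ring.
Unshelve. all: by end_near. Qed.

Lemma pv_fraclap_eq s w1 w2 F1 F2 : (forall x, 0 < x -> w1 x = w2 x) ->
  (forall x, 0 < x < 1 -> F1 x = F2 x) -> pv_fraclap s w1 F1 -> pv_fraclap s w2 F2.
Proof.
move=> ew eF h x x01; have [Gm [Gp [cg dm dp cd e]]] := h x x01.
have /andP[x0 _] := x01.
exists Gm, Gp; split => //.
- by move=> y yx; rewrite -!ew //; [exact: dm|case/andP: yx].
- by move=> y xy; rewrite -!ew //; [exact: dp|exact: lt_trans xy].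
- by rewrite -eF // -!ew.
Qed.

(* By Taylor's formula for [Q], [Q(ln x) - t^p Q(ln x + ln t)] is the combination
   of the [taylor_log p i t] with coefficients [Q^(i)(ln x)]: see [taylor_log_sum]. *)
Definition taylor_log p i t : R := (i == 0%N)%:R - plog p (i`!%:R^-1 *: 'X^i) t.

Lemma taylor_log_kernel s p i : s < 1 -> 0 < p ->
  exists Am Ap : R -> R,
  [/\ Am 0 = 0, Am y @[y --> 0^'+] --> 0,
      forall t, 0 < t < 1 -> D1 Am t (taylor_log p i t * (1 - t) `^ (- (1 + 2 * s))),
      forall t, 1 < t -> D1 Ap t (taylor_log p i t * (t - 1) `^ (- (1 + 2 * s))) &
      Am (1 - r) - Ap (1 + r) @[r --> 0^'+] --> 0].
Proof.
move=> s1 p0; pose Q : {poly R} := i`!%:R^-1 *: 'X^i.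
pose Q1 := p *: Q + Q^`(); pose Q2 := (p - 1) *: Q1 + Q1^`().
apply: (@kernel_primitives _ (fun t => - plog (p - 1) Q1 t)
   (fun t => - plog (p - 1 - 1) Q2 t)).
- lra.
- rewrite /taylor_log /plog powR1 mul1r ln1 hornerZ hornerXn expr0n.
  have [i0|i0] := eqVneq i 0%N; last by rewrite mulr0 subrr.
  by rewrite i0 fact0 invr1 mulr1 subrr.
- move=> t t0; apply: D1_eq (D1_sub (D1_cst _ _) (D1_plog p Q t0)) _.
  by rewrite sub0r.
- by move=> t t0; exact: D1_opp (D1_plog _ Q1 t0).
- by move=> t t0; exact: D1_cont (D1_opp (D1_plog _ Q2 t0)).
have [M [_ hM]] := plog_bound Q p0.
exists (1 + M) => t /half_lt1 t01; rewrite (le_trans (ler_normB _ _)) //.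
apply: lerD; first by case: (i == 0%N); rewrite ?normr1 ?normr0.
by have := hM _ t01; rewrite powRr0 mulr1.
Qed.

Lemma taylor_log_sum p n Q a t : (size Q <= n.+1)%N ->
  \sum_(i < n.+1) Q^`(i).[a] * taylor_log p i t
  = Q.[a] - t `^ p * Q.[a + ln t].
Proof.
move=> sQ; rewrite (@nderiv_taylor_wide _ n.+1) //; last exact: mulrC.
rewrite mulr_sumr [X in X - _](_ : _ = \sum_(i < n.+1) Q^`(i).[a] * (nat_of_ord i == 0%N)%:R).
  rewrite -sumrB; apply: eq_bigr => i _.
  rewrite /taylor_log /plog hornerZ hornerXn nderivn_def hornerMn -[_ *+ i`!]mulr_natr.
  have : i`!%:R != 0 :> R by rewrite pnatr_eq0 -lt0n fact_gt0.
  by move=> h; field.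
rewrite big_ord_recl /= mulr1 big1 ?addr0 // => i _.
by rewrite mulr0.
Qed.

(* The substitution [y = x t] turns the singular integral of [x^p Q(ln x)] over
   (0, 1) into [x^(p - 2 s)] times integrals in [t] up to [1 / x]. *)
Definition frac_plog s p (Ap : nat -> R -> R) n Q x : R :=
  x `^ (p - 2 * s) * (\sum_(i < n.+1) Q^`(i).[ln x] * Ap i (x `^ (-1)))
  + plog p Q x * x `^ (- (2 * s)) / (2 * s)
  + (plog p Q x - Q.[0]) * (1 - x) `^ (- (2 * s)) / (2 * s).

Section plog_pv.
Variables (s p : R) (Am Ap : nat -> R -> R) (n : nat).
Hypotheses (s0 : 0 < s) (p0 : 0 < p).
Hypothesis Am0 : forall i, Am i 0 = 0.
Hypothesis cAm : forall i, Am i y @[y --> 0^'+] --> 0.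
Hypothesis dAm : forall i t, 0 < t < 1 ->
  D1 (Am i) t (taylor_log p i t * (1 - t) `^ (- (1 + 2 * s))).
Hypothesis dAp : forall i t, 1 < t ->
  D1 (Ap i) t (taylor_log p i t * (t - 1) `^ (- (1 + 2 * s))).
Hypothesis cA : forall i, Am i (1 - r) - Ap i (1 + r) @[r --> 0^'+] --> 0.

Lemma pv_fraclap_plog Q : (size Q <= n.+1)%N ->
  pv_fraclap s (plog p Q) (frac_plog s p Ap n Q).
Proof.
move=> sQ x x01; have /andP[x0 x1] := x01.
pose Gm y := x `^ (p - 2 * s) * \sum_(i < n.+1) Q^`(i).[ln x] * Am i (y * x^-1).
pose Gp y := x `^ (p - 2 * s) * \sum_(i < n.+1) Q^`(i).[ln x] * Ap i (y * x^-1).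
have xi0 : 0 < x^-1 by rewrite invr_gt0.
have dsc y : D1 (fun y => y * x^-1) y x^-1.
  by apply: D1_eq (D1_mul (D1_id y) (D1_cst x^-1 y)) _; ring.
(* Count of powers of [x] under [y = x t]: [p - 2 s] in front, [1 + 2 s] from the kernel and [-1]
   from the chain rule add up to [p]. *)
have key y z : 0 < y -> 0 < z -> x `^ (p - 2 * s) *
    (\sum_(i < n.+1) Q^`(i).[ln x] * (taylor_log p i (y * x^-1) *
       (z * x^-1) `^ (- (1 + 2 * s)) * x^-1)) =
    (plog p Q x - plog p Q y) * z `^ (- (1 + 2 * s)).
  move=> y0 z0.
  rewrite [X in _ * X](_ : _ = (\sum_(i < n.+1) Q^`(i).[ln x] * taylor_log p i (y * x^-1)) *
     ((z * x^-1) `^ (- (1 + 2 * s)) * x^-1)); last first.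
    by rewrite mulr_suml; apply: eq_bigr => i _; rewrite !mulrA.
  rewrite taylor_log_sum // lnM ?posrE // lnV ?posrE //.
  rewrite [ln x + _]addrC subrK !powRM ?(ltW y0) ?(ltW z0) ?(ltW xi0) //.
  rewrite -(powR_inv1 (ltW x0)) -!powRrM /plog.
  have -> : x `^ (-1 * - (1 + 2 * s)) = x * x `^ (2 * s).
    by rewrite -{2}(pow_1 x0) -pow_split //; congr (_ `^ _); ring.
  rewrite pow_split // powRN mulN1r !powRN (pow_1 x0).
  have : x `^ (2 * s) != 0 by rewrite gt_eqF // powR_gt0.
  have : x `^ p != 0 by rewrite gt_eqF // powR_gt0.
  have : z `^ (1 + 2 * s) != 0 by rewrite gt_eqF // powR_gt0.
  have : x != 0 by rewrite gt_eqF.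
  move: (x `^ p) (x `^ (2 * s)) (z `^ _) => u v t hx ht hu hv.
  by field; rewrite hx ht hu hv.
exists Gm, Gp; split.
- split.
    by rewrite /Gm big1 ?mulr0 // => i _; rewrite mul0r Am0 mulr0.
  rewrite -[X in _ --> X](mulr0 (x `^ (p - 2 * s))); apply: cvgMr.
  apply: (@cvg_sum0 _ (fun i => Q^`(i).[ln x]) (fun i y => Am i (y * x^-1))) => i _.
  exact: cvg_right_scale.
- move=> y /andP[y0 yx].
  have yx1 : 0 < y * x^-1 < 1 by rewrite mulr_gt0 //= ltr_pdivrMr // mul1r.
  rewrite -key ?subr_gt0 //; apply: D1_scale.
  apply: (@D1_sum _ _ (fun i y => Q^`(i).[ln x] * Am i (y * x^-1)) (fun i =>
    Q^`(i).[ln x] * (taylor_log p i (y * x^-1) *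
       ((x - y) * x^-1) `^ (- (1 + 2 * s)) * x^-1))) => i _.
  have e : (x - y) * x^-1 = 1 - y * x^-1 by rewrite mulrBl mulfV ?gt_eqF.
  apply: D1_scale; rewrite e; apply: (@D1_comp _ _ (fun y => y * x^-1)) => //.
  exact: dAm.
- move=> y yx; have y0 := lt_trans x0 yx.
  have yx1 : 1 < y * x^-1 by rewrite ltr_pdivlMr // mul1r.
  rewrite -key ?subr_gt0 //; apply: D1_scale.
  apply: (@D1_sum _ _ (fun i y => Q^`(i).[ln x] * Ap i (y * x^-1)) (fun i =>
    Q^`(i).[ln x] * (taylor_log p i (y * x^-1) *
       ((y - x) * x^-1) `^ (- (1 + 2 * s)) * x^-1))) => i _.
  have e : (y - x) * x^-1 = y * x^-1 - 1 by rewrite mulrBl mulfV ?gt_eqF.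
  apply: D1_scale; rewrite e; apply: (@D1_comp _ _ (fun y => y * x^-1)) => //.
  exact: dAp.
- have h : x `^ (p - 2 * s) * (\sum_(i < n.+1) Q^`(i).[ln x] *
     (Am i (1 - r * x^-1) - Ap i (1 + r * x^-1))) @[r --> 0^'+] --> x `^ (p - 2 * s) * 0.
    apply: cvgMr; apply: (@cvg_sum0 _ (fun i => Q^`(i).[ln x])
     (fun i r => Am i (1 - r * x^-1) - Ap i (1 + r * x^-1))) => i _.
    exact: (@cvg_right_scale x^-1 (fun r => Am i (1 - r) - Ap i (1 + r))).
  rewrite mulr0 in h; apply: cvg_trans h; apply: near_eq_cvg; near=> r.
  rewrite /Gm /Gp -mulrBr -sumrB; congr (_ * _); apply: eq_bigr => i _.
  by rewrite -mulrBr mulrBl mulrDl mulfV // gt_eqF.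
- rewrite /frac_plog /Gp mul1r (powR_inv1 (ltW x0)).
  by congr (_ + _ + (_ - _) * _ / _); rewrite /plog powR1 mul1r ln1.
Unshelve. all: by end_near. Qed.

(** Dilation identity with a corner. The numerator in the last coefficient is the derivative of
    [x^p Q(ln x)] at [1], that is, the slope lost there, and [(1 - x)^(- 2 s) / (2 s)] is the
    integral of the kernel over [y > 1]. *)
Lemma frac_plog_ode Q x : (size Q <= n.+1)%N -> 0 < x < 1 ->
  D1 (frac_plog s p Ap n Q) x (x `^ (-1) * ((p - 2 * s) * frac_plog s p Ap n Q x
    + frac_plog s p Ap n Q^`() x
    + (p * Q.[0] + Q^`().[0]) / (2 * s) * (1 - x) `^ (- (2 * s)))).
Proof.
move=> sQ /andP[x0 x1].
have xi1 : 1 < x `^ (-1) by rewrite powR_inv1 ?ltW // invf_gt1.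
have dS : D1 (fun x => \sum_(i < n.+1) Q^`(i).[ln x] * Ap i (x `^ (-1))) x
   (\sum_(i < n.+1) (Q^`(i.+1).[ln x] * x^-1 * Ap i (x `^ (-1)) + Q^`(i).[ln x] *
     (taylor_log p i (x `^ (-1)) * (x `^ (-1) - 1) `^ (- (1 + 2 * s)) * (-1 * x `^ (-1 - 1))))).
  apply: (@D1_sum _ _ (fun i x => Q^`(i).[ln x] * Ap i (x `^ (-1)))
    (fun i => Q^`(i.+1).[ln x] * x^-1 * Ap i (x `^ (-1)) + Q^`(i).[ln x] *
     (taylor_log p i (x `^ (-1)) * (x `^ (-1) - 1) `^ (- (1 + 2 * s)) * (-1 * x `^ (-1 - 1))))).
  move=> i _; apply: D1_mul; first by rewrite derivnS; exact: D1_poly_ln.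
  by apply: (@D1_comp _ (Ap i) (fun x => x `^ (-1))); [exact: dAp|exact: D1_pow].
pose S Q := \sum_(i < n.+1) Q^`(i).[ln x] * Ap i (x `^ (-1)).
(* The first half of each summand reproduces the sum for the derivative of [Q]. The second half is
   the boundary term at [y = 1]: [taylor_log_sum] at [t = 1 / x], where [ln x + ln t = 0] leaves
   [Q.[0]]. *)
have eS : \sum_(i < n.+1) (Q^`(i.+1).[ln x] * x^-1 * Ap i (x `^ (-1)) + Q^`(i).[ln x] *
     (taylor_log p i (x `^ (-1)) * (x `^ (-1) - 1) `^ (- (1 + 2 * s)) * (-1 * x `^ (-1 - 1))))
   = x^-1 * S Q^`() - x `^ (2 * s - 1) * (1 - x) `^ (- (2 * s)) / (1 - x) *
      (Q.[ln x] - x `^ (- p) * Q.[0]).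
  rewrite big_split /=; congr (_ + _).
    by rewrite /S mulr_sumr; apply: eq_bigr => i _; rewrite -derivnS derivSn; ring.
  rewrite [LHS](_ : _ = (\sum_(i < n.+1) Q^`(i).[ln x] * taylor_log p i (x `^ (-1))) *
     ((x `^ (-1) - 1) `^ (- (1 + 2 * s)) * (-1 * x `^ (-1 - 1)))); last first.
    by rewrite mulr_suml; apply: eq_bigr => i _; rewrite !mulrA.
  rewrite taylor_log_sum // (_ : ln x + ln (x `^ (-1)) = 0); last first.
    by rewrite ln_powR mulN1r subrr.
  rewrite -[(x `^ (-1)) `^ p]powRrM (mulN1r p).
  have -> : x `^ (-1) - 1 = (1 - x) * x `^ (-1).
    by rewrite powR_inv1 ?ltW // mulrBl mul1r mulfV // gt_eqF.
  rewrite powRM ?subr_ge0 ?powR_ge0 ?(ltW x1) // -powRrM.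
  rewrite (_ : - (1 + 2 * s) = - (2 * s) - 1); last ring.
  rewrite [in (1 - x) `^ _]pow_split ?subr_gt0 // powR_inv1 ?subr_ge0 ?(ltW x1) //.
  rewrite (_ : x `^ (2 * s - 1) = x `^ (-1 * (- (2 * s) - 1)) * x `^ (-1 - 1)); last first.
    by rewrite -pow_split //; congr (_ `^ _); ring.
  ring.
have d1 := D1_mul (D1_pow (p - 2 * s) x0) dS.
have d2 := D1_mul (D1_mul (D1_plog p Q x0) (D1_pow (- (2 * s)) x0)) (D1_cst (2 * s)^-1 x).
have d3 := D1_mul (D1_mul (D1_sub (D1_plog p Q x0) (D1_cst Q.[0] x))
   (D1_onem_pow (- (2 * s)) x1)) (D1_cst (2 * s)^-1 x).
apply: D1_eq (D1_add (D1_add d1 d2) d3) _.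
rewrite eS /frac_plog -!/(S _) /plog !hornerD !hornerZ.
have y0 : 0 < 1 - x by rewrite subr_gt0.
rewrite ![_ `^ (_ - 1)]pow_split // !powR_inv1 ?(ltW x0) ?(ltW y0) //.
rewrite (pow_split p) // !powRN.
have : x `^ (2 * s) != 0 by rewrite gt_eqF // powR_gt0.
have : x `^ p != 0 by rewrite gt_eqF // powR_gt0.
have : (1 - x) `^ (2 * s) != 0 by rewrite gt_eqF // powR_gt0.
have : x != 0 by rewrite gt_eqF.
have : 1 - x != 0 by rewrite gt_eqF.
have : s != 0 by rewrite gt_eqF.
move: (x `^ p) (x `^ (2 * s)) ((1 - x) `^ _) (S Q) (S Q^`()) Q.[ln x] Q.[0] Q^`().[ln x] Q^`().[0].
move=> u v z SQ SQ' a1 a2 a3 a4 h1 h2 h3 h4 h5 h6.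
by field; rewrite h1 h2 h3 h4 h5 h6.
Qed.

End plog_pv.

End principal_value.

(** * Expansion of the fractional Laplacian at the origin *)

Section expansion.
Context {R : realType}.
Set Implicit Arguments.
Unset Strict Implicit.
Unset Printing Implicit Defensive.
Implicit Types (f g h r w F : R -> R) (a b c x y z t p s M N e : R) (P Q A : {poly R}).

Lemma D1_plog_euler p Q x : 0 < x ->
  D1 (plog p Q) x (x `^ (-1) * (p * plog p Q x + plog p Q^`() x)).
Proof.
move=> x0; apply: D1_eq (D1_plog p Q x0) _.
by rewrite [p - 1]addrC -plogM // plogD plogZ.
Qed.

(** Monomial by monomial: [c x^i] is produced by [c / (i - b) x^i], except in the resonant case
    [b = i], which requires [c x^b ln x]. *)
Lemma euler_poly b P : exists P' Q', forall x, 0 < x ->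
  D1 (fun x => P'.[x] + plog b Q' x) x
     (x `^ (-1) * (b * (P'.[x] + plog b Q' x) + P.[x])).
Proof.
rewrite -[P]coefK poly_def.
pose K P := exists P' Q', forall x, 0 < x -> D1 (fun x => P'.[x] + plog b Q' x) x
     (x `^ (-1) * (b * (P'.[x] + plog b Q' x) + P.[x])).
apply: (big_ind K).
- exists 0, 0 => x x0; apply: D1_eq (D1_add (D1_horner 0 x) (D1_plog b 0 x0)) _.
  by rewrite deriv0 scaler0 addr0 /plog !horner0; ring.
- move=> P1 P2 [P1' [Q1 h1]] [P2' [Q2 h2]].
  exists (P1' + P2'), (Q1 + Q2) => x x0.
  rewrite (_ : (fun _ => _) = fun x => (P1'.[x] + plog b Q1 x) + (P2'.[x] + plog b Q2 x)).
    by apply: D1_eq (D1_add (h1 _ x0) (h2 _ x0)) _; rewrite !hornerD plogD; ring.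
  by apply/funext => y; rewrite hornerD plogD; ring.
move=> i _; move: P`_i => c; move: (nat_of_ord i) => {}i.
have [bi|bi] := eqVneq b i%:R.
  exists 0, (c *: 'X) => x x0; apply: D1_eq (D1_add (D1_horner 0 x) (D1_plog_euler _ _ x0)) _.
  rewrite deriv0 !horner0 derivZ derivX hornerZ hornerXn.
  have hb : x `^ b = x ^+ i by rewrite bi powR_mulrn ?ltW.
  by rewrite [plog b (c *: 1) x]/plog hornerZ hornerC hb; ring.
have bi0 : i%:R - b != 0 by rewrite subr_eq0 eq_sym.
exists ((c / (i%:R - b)) *: 'X^i), 0 => x x0.
apply: D1_eq (D1_add (D1_horner _ x) (D1_plog_euler _ _ x0)) _.
rewrite derivZ derivXn deriv0 /plog !hornerZ hornerMn !hornerXn !horner0.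
rewrite powR_inv1 ?ltW // -[x ^+ i.-1 *+ i]mulr_natr.
have xn0 : x != 0 by rewrite gt_eqF.
have xx : x ^+ i.-1 * i%:R = x^-1 * x ^+ i * i%:R.
  by case: i {bi bi0} => [|i]; rewrite ?mulr0 //= exprS mulKf.
have ei : i%:R = (i%:R - b) + b by rewrite subrK.
rewrite xx {2}ei; move: (i%:R - b) (x ^+ i) x^-1 bi0 => d u v d0.
by field.
Qed.

(** The term [x^b Q(ln x)] is always resonant and is integrated in the variable [ln x]; [b < N]
    allows a particular solution for [r] that is as small as [r]. Once the particular solutions are
    removed, the rest is a multiple of [x^b] and joins the power-log term. *)
Lemma euler_ode b Q P r F K N : b < N -> symb K N r ->
  (forall x, 0 < x < 1 ->
     D1 F x (x `^ (-1) * (b * F x + plog b Q x + P.[x] + r x))) ->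
  exists Q' P' r', symb K N r' /\
    forall x, 0 < x < 1 -> F x = plog b Q' x + P'.[x] + r' x.
Proof.
move=> bN hr dF; have [P1 [Q1 h1]] := euler_poly b P.
have [Qp eQ] := poly_primitive Q.
have [g [hg dg]] := @euler_solve R K N (- b) r hr ltac:(lra).
pose E x := F x - (P1.[x] + plog b Q1 x) - plog b Qp x - g x.
have dH x : 0 < x < 1 -> D1 (fun x => x `^ (- b) * E x) x 0.
  move=> x01; have x0 : 0 < x by case/andP: x01.
  apply: D1_eq (D1_mul (D1_pow _ x0) (D1_sub (D1_sub (D1_sub (dF _ x01) (h1 _ x0))
    (D1_plog_euler _ _ x0)) (dg _ x01))) _.
  rewrite eQ (pow_split (- b)) // /E; ring.
pose C := (1 / 2) `^ (- b) * E (1 / 2).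
exists (C%:P + Q1 + Qp), P1, g; split => // x x01; have x0 : 0 < x by case/andP: x01.
have hh : 0 < (1 / 2 : R) < 1 by lra.
have := @D1_0_cst R 0 1 (fun x => x `^ (- b) * E x) dH _ _ x01 hh.
rewrite -/C => eC; rewrite !plogD {1}/plog hornerC -eC mulrA -pow_split // subrr powRr0.
by rewrite /E; ring.
Qed.

Lemma frac_plog_expansion s p Ap n Q K N : 0 < s -> 0 < p ->
  (forall i t, 1 < t -> D1 (Ap i) t (taylor_log p i t * (t - 1) `^ (- (1 + 2 * s)))) ->
  (size Q <= n.+1)%N ->
  exists Q' P r, symb K N r /\
    forall x, 0 < x < 1 -> frac_plog s p Ap n Q x = plog (p - 2 * s) Q' x + P.[x] + r x.
Proof.
(* [euler_ode] needs an order beyond [p - 2 s]; the result is weakened to [N] at the end. The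
   induction is on the size of [Q], since the Euler equation for [Q] involves [frac_plog] of its
   derivative. *)
move=> s0 p0 dAp; pose N' := Num.max N (p - 2 * s + 1).
suff H m : forall Q, (size Q <= m)%N -> (size Q <= n.+1)%N -> exists Q' P r, symb K N' r /\
    forall x, 0 < x < 1 -> frac_plog s p Ap n Q x = plog (p - 2 * s) Q' x + P.[x] + r x.
  move=> sQ; have [Q' [P [r [hr e]]]] := H _ _ (leqnn _) sQ.
  exists Q', P, r; split => //; apply: symb_le hr.
  by rewrite le_max lexx.
elim: m => [|m IH] {}Q sQ sQn.
  move: sQ; rewrite leqn0 size_poly_eq0 => /eqP ->.
  exists 0, 0, (fun=> 0); split; first exact: symb_cst0.
  move=> x x01; rewrite /frac_plog /plog !horner0 big1; first by ring.
  have d0 k : (0 : {poly R})^`(k) = 0 by elim: k => // k IHk; rewrite derivnS IHk deriv0.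
  by move=> i _; rewrite d0 horner0 mul0r.
have sQ' : (size Q^`() <= m)%N.
  have [->|Q0] := eqVneq Q 0; first by rewrite deriv0 size_poly0.
  by rewrite -ltnS; apply: leq_trans sQ; exact: lt_size_deriv.
have sQn' : (size Q^`() <= n.+1)%N.
  have [->|Q0] := eqVneq Q 0; first by rewrite deriv0 size_poly0.
  by apply: leq_trans sQn; apply: ltnW; exact: lt_size_deriv.
have [Q1 [P1 [r1 [hr1 e1]]]] := IH _ sQ' sQn'.
pose c := (p * Q.[0] + Q^`().[0]) / (2 * s).
have [P2 [r2 [hr2 e2]]] := taylor_scale c (taylor_onem (- (2 * s))) K N'.
apply: (@euler_ode _ Q1 (P1 + P2) (fun x => r1 x + r2 x)).
- by rewrite lt_max; apply/orP; right; lra.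
- exact: symb_add.
move=> x x01; apply: D1_eq (frac_plog_ode s0 dAp sQn x01) _.
by rewrite e1 // -/c e2 // hornerD; ring.
Qed.

Lemma pv_fraclap_plog_expansion s p Q : 0 < s -> s < 1 -> 0 < p ->
  exists F, pv_fraclap s (plog p Q) F /\
   forall K N, exists Q' P r, symb K N r /\
    forall x, 0 < x < 1 -> F x = plog (p - 2 * s) Q' x + P.[x] + r x.
Proof.
move=> s0 s1 p0.
have H i : exists A : (R -> R) * (R -> R),
  [/\ A.1 0 = 0, A.1 y @[y --> 0^'+] --> 0,
      forall t, 0 < t < 1 -> D1 A.1 t (taylor_log p i t * (1 - t) `^ (- (1 + 2 * s))),
      forall t, 1 < t -> D1 A.2 t (taylor_log p i t * (t - 1) `^ (- (1 + 2 * s))) &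
      A.1 (1 - r) - A.2 (1 + r) @[r --> 0^'+] --> 0].
  by have [Am [Ap h]] := taylor_log_kernel i s1 p0; exists (Am, Ap).
have [A hA] := choice H.
exists (frac_plog s p (fun i => (A i).2) (size Q) Q); split.
  by apply: (@pv_fraclap_plog _ s p (fun i => (A i).1)) => // i; case: (hA i).
move=> K N; apply: frac_plog_expansion => //.
by move=> i; case: (hA i).
Qed.

Lemma cvg_right_eq0 f : (forall x, 0 < x -> f x = 0) -> f x @[x --> 0^'+] --> 0.
Proof.
move=> f0; have h : (fun=> 0 : R) x @[x --> (0 : R)^'+] --> (0 : R) by exact: cvg_cst.
by apply: cvg_trans h; apply: near_eq_cvg; near=> x; rewrite f0.
Unshelve. all: by end_near. Qed.

(** This case is computed by hand because the value of the leading coefficient decides the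
    regularity of [u]. The integrand is odd about [x], so the two primitives match exactly; for
    [e = 1 - 2 s] nonzero, the inner part and the tails contribute [1 / e] and [1 / (2 s)], whose
    sum is [1 / (2 s e)]. *)
Lemma pv_fraclap_id s : 0 < s -> s < 1 -> exists F Q0,
  [/\ pv_fraclap s id F, taylor (fun x => F x - plog (1 - 2 * s) Q0 x),
      s != 1 / 2 -> Q0 = (2 * s * (1 - 2 * s))^-1%:P &
      s = 1 / 2 -> Q0 = 'X].
Proof.
move=> s0 s1; have s20 : 2 * s != 0 by lra.
have pe z : 0 < z -> z * z `^ (- (1 + 2 * s)) = z `^ (1 - 2 * s - 1).
  by move=> z0; rewrite -{1}(pow_1 z0) -pow_split //; congr (_ `^ _); ring.
have dl x y : y < x -> D1 (fun y => x - y) y (- 1).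
  by move=> _; apply: D1_eq (D1_sub (D1_cst x y) (D1_id y)) _; ring.
have dr x y : D1 (fun y => y - x) y 1.
  by apply: D1_eq (D1_sub (D1_id y) (D1_cst x y)) _; ring.
have [sh|sh] := eqVneq s (1 / 2).
  have s2 : 2 * s = 1 by rewrite sh; field.
  exists (fun x => ln x - ln (1 - x)), 'X; split => //; last first.
    move=> K N; have [P [r [hr e]]] := taylor_scale (- 1) taylor_ln_onem K N.
    exists P, r; split => // x x01.
    by rewrite -e // /plog s2 subrr powRr0 hornerX; ring.
  move=> x /andP[x0 x1].
  have dm y : y < x -> D1 (fun y => ln x - ln (x - y)) y ((x - y)^-1).
    move=> yx; have h : 0 < x - y by rewrite subr_gt0.
    apply: D1_eq (D1_sub (D1_cst _ y) (@D1_comp _ (@ln R) (fun y => x - y) _ _ _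
      (D1_ln h) (dl _ _ yx))) _.
    by ring.
  exists (fun y => ln x - ln (x - y)), (fun y => ln x - ln (y - x)); split.
  - split; first by rewrite subr0 subrr.
    by have := D1_cont (dm _ x0); rewrite subr0 subrr => /cvg_at_right_filter.
  - move=> y /andP[y0 yx]; have h : 0 < x - y by rewrite subr_gt0.
    rewrite pe // s2 (_ : 1 - 1 - 1 = -1); last ring.
    by rewrite powR_inv1 ?ltW //; exact: dm.
  - move=> y yx; have h : 0 < y - x by rewrite subr_gt0.
    apply: D1_eq (D1_sub (D1_cst _ y) (@D1_comp _ (@ln R) (fun y => y - x) _ _ _
      (D1_ln h) (dr x y))) _.
    rewrite -[x - y]opprB mulNr pe // s2 (_ : 1 - 1 - 1 = -1); last ring.
    by rewrite powR_inv1 ?ltW //; ring.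
  - apply: cvg_right_eq0 => r _.
    have e1 : x - (x - r) = r by ring.
  have e2 : x + r - x = r by ring.
  by rewrite e1 e2 subrr.
  - rewrite s2 !powR_inv1 ?subr_ge0 ?ltW //.
    have : 1 - x != 0 by rewrite gt_eqF // subr_gt0.
    have : x != 0 by rewrite gt_eqF.
    by move=> h1 h2; field; rewrite h1 h2.
pose e := 1 - 2 * s; have e0 : e != 0 by rewrite /e; apply: contra_neq sh; lra.
exists (fun x => (x `^ e - (1 - x) `^ e) / (2 * s * e)), (2 * s * e)^-1%:P; split => //; last first.
  by move=> sh'; rewrite sh' eqxx in sh.
  move=> K N; have [P [r [hr er]]] := taylor_scale (- (2 * s * e)^-1) (taylor_onem e) K N.
  exists P, r; split => // x x01.
  by rewrite -er // /plog hornerC; ring.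
move=> x /andP[x0 x1].
have dm y : y < x -> D1 (fun y => (x `^ e - (x - y) `^ e) / e) y ((x - y) `^ (e - 1)).
  move=> yx; have h : 0 < x - y by rewrite subr_gt0.
  apply: D1_eq (D1_mul (D1_sub (D1_cst _ y) (@D1_comp _ (fun z => z `^ e) (fun y => x - y) _ _ _
      (D1_pow e h) (dl _ _ yx))) (D1_cst e^-1 y)) _.
  by field.
exists (fun y => (x `^ e - (x - y) `^ e) / e), (fun y => (x `^ e - (y - x) `^ e) / e); split.
- split; first by rewrite subr0 subrr mul0r.
  by have := D1_cont (dm _ x0); rewrite subr0 subrr mul0r => /cvg_at_right_filter.
- move=> y /andP[y0 yx]; have h : 0 < x - y by rewrite subr_gt0.
  by rewrite pe //; exact: dm.
- move=> y yx; have h : 0 < y - x by rewrite subr_gt0.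
  apply: D1_eq (D1_mul (D1_sub (D1_cst _ y) (@D1_comp _ (fun z => z `^ e) (fun y => y - x) _ _ _
      (D1_pow e h) (dr x y))) (D1_cst e^-1 y)) _.
  by rewrite -[x - y]opprB mulNr pe // -/e; field.
- apply: cvg_right_eq0 => r _.
  have e1 : x - (x - r) = r by ring.
  have e2 : x + r - x = r by ring.
  by rewrite e1 e2 subrr.
- rewrite -[x * _]/(x * _); have x1' : 0 < 1 - x by rewrite subr_gt0.
  have pe2 z : 0 < z -> z `^ e = z * z `^ (- (2 * s)).
    by move=> z0; rewrite /e pow_split // pow_1.
  rewrite !pe2 //; move: (x `^ _) ((1 - x) `^ _) => u v.
  have es : 2 * s = 1 - e by rewrite /e; ring.
  have : 1 - e != 0 by rewrite -es.
  by rewrite es => e1; field; rewrite e0 e1.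
Qed.

End expansion.

(** * Successive corrections *)

Section correction.
Context {R : realType}.
Set Implicit Arguments.
Unset Strict Implicit.
Unset Printing Implicit Defensive.
Implicit Types (f g h r w F : R -> R) (a b c x y z t p s M N e kappa : R).
Implicit Types (P Q A : {poly R}) (l : seq (R * {poly R})).

Definition plogs l x := \sum_(q <- l) plog q.1 q.2 x.

Definition dplogs l := [seq (q.1 - 1, q.1 *: q.2 + q.2^`()) | q <- l].

Lemma plogs_cons q l x : plogs (q :: l) x = plog q.1 q.2 x + plogs l x.
Proof. by rewrite /plogs big_cons. Qed.

Lemma plogs_nil x : plogs [::] x = 0.
Proof. by rewrite /plogs big_nil. Qed.

Lemma D1_plogs l x : 0 < x -> D1 (plogs l) x (plogs (dplogs l) x).
Proof.
move=> x0; elim: l => [|q l IH].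
  rewrite plogs_nil (_ : plogs [::] = fun=> 0); first exact: D1_cst.
  by apply/funext => y; rewrite plogs_nil.
rewrite (_ : plogs (q :: l) = fun y => plog q.1 q.2 y + plogs l y); last first.
  by apply/funext => y; rewrite plogs_cons.
by rewrite [dplogs _]/= plogs_cons; apply: D1_add IH; exact: D1_plog.
Qed.

(* Every correction [v] removes the singular part [plog q Q] of the residual
   ([v'' = plog q Q]) and creates a new one, less singular by [2 - 2 s]. *)
Lemma correction s kappa Q1 Q0 A (F0 : R -> R) K N (j : nat) : 0 < s -> s < 1 ->
  pv_fraclap s id F0 -> taylor (fun x => F0 x - plog (1 - 2 * s) Q0 x) ->
  (3 - 2 * s) *: Q1 + Q1^`() = A -> (2 - 2 * s) *: A + A^`() = kappa *: Q0 ->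
  exists l Q P r F, let L := l ++ [:: (3 - 2 * s, Q1); (1, 1%:P)] in
  [/\ all (fun q => 5 - 4 * s <= q.1) l, pv_fraclap s (plogs L) F, symb K N r &
      forall x, 0 < x < 1 -> kappa * F x - plogs (dplogs (dplogs L)) x =
        P.[x] + r x + plog (1 - 2 * s + (2 - 2 * s) * j.+1%:R) Q x].
Proof.
move=> s0 s1 pv0 t0 eA eQ0; elim: j => [|j [l [Q [P [r [F [hl pvL hr e]]]]]]].
  (* By the choice of [Q1], the second derivative of [x^(3 - 2 s) Q1(ln x)] is
     [kappa x^(1 - 2 s) Q0(ln x)], the singular part created by [x]. The new singular part has
     exponent [3 - 4 s]. *)
  have [|F1 [pv1 h1]] := pv_fraclap_plog_expansion (p := 3 - 2 * s) Q1 s0 s1; first lra.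
  have [Q [P [r [hr e1]]]] := h1 K N.
  have [P' [r' [hr' e0]]] := t0 K N.
  exists [::], (kappa *: Q), (kappa *: (P' + P)), (fun x => kappa * (r' x + r x)).
  exists (fun x => F1 x + F0 x); split => //.
  - apply: pv_fraclap_eq (pv_fraclap_add pv1 pv0) => // x x0.
    by rewrite !plogs_cons plogs_nil /= /plog hornerC pow_1 //; ring.
  - by apply: symb_scale; exact: symb_add.
  move=> x x01; have e0' : F0 x = P'.[x] + r' x + plog (1 - 2 * s) Q0 x.
    by rewrite -e0 // subrK.
  rewrite e1 // e0' /= !plogs_cons plogs_nil /= eA.
  rewrite (_ : 3 - 2 * s - 1 = 2 - 2 * s); last ring.
  rewrite eQ0 (_ : 2 - 2 * s - 1 = 1 - 2 * s); last ring.
  have -> : (1 - 1) *: (1 *: 1%:P + (1%:P)^`()) + (1 *: 1%:P + (1%:P)^`())^`() = 0 :> {poly R}.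
    by rewrite subrr scale0r add0r scale1r !derivD !derivC ?deriv0 addr0.
  rewrite (_ : 3 - 2 * s - 2 * s = 1 - 2 * s + (2 - 2 * s) * 1%:R); last ring.
  by rewrite !plogZ hornerZ hornerD /plog hornerC; ring.
pose q := 1 - 2 * s + (2 - 2 * s) * j.+1%:R.
have j0 : 0 <= j%:R :> R by [].
have js : j.+1%:R = j%:R + 1 :> R by rewrite -natr1.
(* As [s < 1], this gives [q + 1 > 0] and [q + 2 > 0], so the residual has a second primitive of
   power-log type; it also gives the exponent bound [5 - 4 s <= q + 2]. *)
have jq : 3 - 4 * s <= q.
  have : 0 <= (2 - 2 * s) * j%:R by rewrite mulr_ge0 //; lra.
  by rewrite /q js; lra.
have [A' eA'] := @plog_solve R (q + 1) Q ltac:(rewrite gt_eqF //; lra).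
have [V eV] := @plog_solve R (q + 2) A' ltac:(rewrite gt_eqF //; lra).
have [|F1 [pv1 h1]] := pv_fraclap_plog_expansion (p := q + 2) V s0 s1; first lra.
have [Q' [P' [r' [hr' e1]]]] := h1 K N.
exists ((q + 2, V) :: l), (kappa *: Q'), (P + kappa *: P'), (fun x => r x + kappa * r' x).
exists (fun x => F1 x + F x); split => //.
- by rewrite /= hl andbT; lra.
- apply: pv_fraclap_eq (pv_fraclap_add pv1 pvL) => // x x0.
  by rewrite [_ ++ _]/= plogs_cons.
- by apply: symb_add => //; exact: symb_scale.
move=> x x01; rewrite /= !plogs_cons /= eV (_ : q + 2 - 1 = q + 1); last ring.
rewrite eA' (_ : q + 1 - 1 = q); last ring.
have := e _ x01; rewrite -/q => {}e.
rewrite (_ : 1 - 2 * s + (2 - 2 * s) * j.+2%:R = q + 2 - 2 * s); last first.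
  by rewrite /q -[j.+2%:R]natr1; ring.
rewrite mulrDr opprD addrACA e e1 // hornerD hornerZ plogZ; ring.
Qed.

End correction.

(** * Truncated Lebesgue integrals *)

Section lebesgue.
Context {R : realType}.
Set Implicit Arguments.
Unset Strict Implicit.
Unset Printing Implicit Defensive.
Implicit Types (f g h w F G : R -> R) (a b c d x y z t s M N e v : R).
Implicit Types (A B : set (measurableTypeR R)).

Notation mu := (@lebesgue_measure R).

Lemma D1_derive1 f x d : D1 f x d -> f^`()%classic x = d.
Proof. by move=> h; rewrite derive1E; exact: (@derive_val _ _ _ _ _ _ _ h). Qed.

Lemma D1_derivable f x d : D1 f x d -> derivable f x 1.
Proof. by case. Qed.

(** Integrability is carried along because adding integrals over disjoint sets requires it. *)
Definition has_integral A f v : Prop :=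
  [/\ measurable A, mu.-integrable A (EFin \o f) & \int[mu]_(x in A) f x = v].

Lemma has_integralU A B f v v' : A `&` B `<=` set0 -> has_integral A f v ->
  has_integral B f v' -> has_integral (A `|` B) f (v + v').
Proof.
move=> AB [mA iA eA] [mB iB eB]; have mAB : measurable (A `|` B) by exact: measurableU.
have dAB : [disjoint A & B] by exact/disj_setPS.
have iAB : mu.-integrable (A `|` B) (EFin \o f).
  have /integrableP[mfA fA] := iA; have /integrableP[mfB fB] := iB.
  have mf : measurable_fun (A `|` B) (EFin \o f) by apply/(measurable_funU _ mA mB); split.
  apply/integrableP; split => //.
  rewrite ge0_integral_setU //.
    exact: lte_add_pinfty.
  exact: measurableT_comp.
by split => //; rewrite Rintegral_setU // eA eB.
Qed.

Lemma has_integral_eq A f g v : (forall x, A x -> f x = g x) ->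
  has_integral A f v -> has_integral A g v.
Proof.
move=> fg [mA iA eA]; split => //.
  by apply: eq_integrable iA => // x; rewrite inE /= => /fg ->.
by rewrite -eA; apply: eq_Rintegral => x; rewrite inE => /fg ->.
Qed.

Lemma has_integralZ A f c v : has_integral A f v ->
  has_integral A (fun x => c * f x) (c * v).
Proof.
move=> [mA iA eA]; split => //; last by rewrite RintegralZl // eA.
by apply: eq_integrable (integrableZl mA c iA) => // x _ /=; rewrite EFinM.
Qed.

(** One-sided limits of [G] suffice at the endpoints; this matters at [0], where only the right
    limit of [Gm] is known. *)
Lemma has_integral_seg a b f G : a < b -> {within `[a, b], continuous f} ->
  (forall y, a < y < b -> D1 G y (f y)) ->
  G y @[y --> a^'+] --> G a -> G y @[y --> b^'-] --> G b ->
  has_integral `[a, b] f (G b - G a).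
Proof.
move=> ab cf dG Ga Gb.
have i : mu.-integrable `[a, b] (EFin \o f).
  by apply: continuous_compact_integrable => //; exact: segment_compact.
split => //.
rewrite /Rintegral (continuous_FTC2 (F := G) ab cf) //.
  by split => // y; rewrite in_itv /= => /dG /D1_derivable.
by move=> y; rewrite in_itv /= => /dG /D1_derive1.
Qed.

Lemma has_integral_oc a b f v : has_integral `[a, b] f v -> has_integral `]a, b] f v.
Proof.
move=> [_ i <-]; have i' : mu.-integrable `]a, b] (EFin \o f).
  by apply: integrableS i => //; exact: subset_itv_oc_cc.
by split => //; rewrite Rintegral_itv_obnd_cbnd.
Qed.

Lemma has_integral_oo a b f v : has_integral `]a, b] f v -> has_integral `]a, b[ f v.
Proof.
move=> [_ i <-]; have i' : mu.-integrable `]a, b[ (EFin \o f).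
  by apply: integrableS i => //; exact: subset_itv_oo_oc.
by split => //; rewrite Rintegral_itv_bndo_bndc.
Qed.

Lemma has_integral_oy a f v : has_integral `[a, +oo[ f v -> has_integral `]a, +oo[ f v.
Proof.
move=> [_ i <-]; have i' : mu.-integrable `]a, +oo[ (EFin \o f).
  by apply: integrableS i => //; apply: subset_itvr; rewrite bnd_simp.
by split => //; rewrite Rintegral_itv_obnd_cbnd.
Qed.

Lemma integrable_ge0 A f v : measurable A -> measurable_fun A f ->
  (forall x, A x -> 0 <= f x) -> (\int[mu]_(x in A) (f x)%:E)%E = v%:E ->
  has_integral A f v.
Proof.
move=> mA mf f0 e; split => //; last by rewrite /Rintegral e.
apply/integrableP; split; first exact/measurable_EFinP.
rewrite (_ : (\int[mu]_(x in A) `|(EFin \o f) x|)%E = v%:E) ?ltry // -e.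
by apply: eq_integral => x; rewrite inE => /f0 h; rewrite /= ger0_norm.
Qed.

Lemma powR_cvgy d b : 0 < b -> (y - d) `^ (- b) @[y --> +oo] --> 0.
Proof.
move=> b0; apply/cvgrPdist_lt => e e0; near=> y.
have he : 0 < e `^ (- b^-1) by rewrite powR_gt0.
have yd : e `^ (- b^-1) < y - d.
  by rewrite ltrBrDr; near: y; apply: nbhs_pinfty_gt; rewrite num_real.
rewrite sub0r normrN ger0_norm ?powR_ge0 // powRN invf_plt ?posrE ?powR_gt0 //; last first.
  exact: lt_trans yd.
have := gt0_ltr_powR b0 _ _ yd; rewrite -powRrM mulNr mulVf ?gt_eqF // powR_inv1 ?ltW //.
by apply; rewrite nnegrE ltW // (lt_trans he yd).
Unshelve. all: by end_near. Qed.

Lemma D1_tail s d y : 0 < s -> d < y ->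
  D1 (fun y => - ((y - d) `^ (- (2 * s)) / (2 * s))) y ((y - d) `^ (- (1 + 2 * s))).
Proof.
move=> s0 dy; have h : 0 < y - d by rewrite subr_gt0.
apply: D1_eq (D1_opp (D1_mul (@D1_comp _ (fun z => z `^ (- (2 * s))) (fun y => y - d) _ _ _
   (D1_pow _ h) (D1_sub (D1_id y) (D1_cst d y))) (D1_cst (2 * s)^-1 y))) _.
rewrite (_ : - (2 * s) - 1 = - (1 + 2 * s)); last ring.
have : s != 0 by rewrite gt_eqF.
by move: (_ `^ _) => u h1; field.
Qed.

Lemma has_integral_tail s d b : 0 < s -> d < b ->
  has_integral `[b, +oo[ (fun y => (y - d) `^ (- (1 + 2 * s)))
    ((b - d) `^ (- (2 * s)) / (2 * s)).
Proof.
move=> s0 db; have s20 : 0 < 2 * s by lra.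
have cf : {within `[b, +oo[, continuous (fun y => (y - d) `^ (- (1 + 2 * s)))}.
  apply: derivable_within_continuous => y; rewrite in_itv /= andbT => yb.
  have h : 0 < y - d by rewrite subr_gt0 (lt_le_trans db).
  exact: D1_derivable (@D1_comp _ (fun z => z `^ (- (1 + 2 * s))) (fun y => y - d) _ _ _
   (D1_pow _ h) (D1_sub (D1_id y) (D1_cst d y))).
apply: integrable_ge0 => //.
- exact: subspace_continuous_measurable_fun.
- by move=> y _; exact: powR_ge0.
rewrite (@ge0_continuous_FTC2y _ _ (fun y => - ((y - d) `^ (- (2 * s)) / (2 * s))) b 0) //.
- by rewrite sub0e -EFinN opprK.
- by move=> y _; exact: powR_ge0.
- have h : - ((y - d) `^ (- (2 * s)) / (2 * s)) @[y --> +oo] --> - (0 / (2 * s)).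
    by apply: cvgN; apply: cvgMl; exact: powR_cvgy.
  by rewrite mul0r oppr0 in h.
- by move=> y yb; exact: D1_derivable (D1_tail s0 (lt_trans db yb)).
- exact: cvg_at_right_filter (D1_cont (D1_tail s0 db)).
- by move=> y; rewrite in_itv /= andbT => yb; exact: D1_derive1 (D1_tail s0 (lt_trans db yb)).
Qed.

Lemma has_integral_tailN s x : 0 < s -> 0 < x ->
  has_integral `]-oo, 0] (fun y => (x - y) `^ (- (1 + 2 * s)))
    (x `^ (- (2 * s)) / (2 * s)).
Proof.
move=> s0 x0; have cf : {within `]-oo, 0], continuous (fun y => (x - y) `^ (- (1 + 2 * s)))}.
  apply: derivable_within_continuous => y; rewrite in_itv /= => yb.
  have h : 0 < x - y by rewrite subr_gt0 (le_lt_trans yb).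
  exact: D1_derivable (@D1_comp _ (fun z => z `^ (- (1 + 2 * s))) (fun y => x - y) _ _ _
   (D1_pow _ h) (D1_sub (D1_cst x y) (D1_id y))).
apply: integrable_ge0 => //.
- exact: subspace_continuous_measurable_fun.
- by move=> y _; exact: powR_ge0.
have nx0 : - x < 0 by rewrite oppr_lt0.
have [_ i e] := has_integral_tail s0 nx0.
have ex : 0 - - x = x by ring.
rewrite ex in e; rewrite -e.
have := @ge0_integration_by_substitutionNy R (fun y => (x - y) `^ (- (1 + 2 * s))) 0.
rewrite oppr0 => -> //; last by move=> y _; exact: powR_ge0.
rewrite /Rintegral fineK; last exact: integrable_fin_num.
by apply: eq_integral => y _ /=; rewrite !opprK addrC.
Qed.

Definition clamp y : R := Num.min (Num.max y 0) 1.

Lemma clamp_le0 y : y <= 0 -> clamp y = 0.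
Proof. by move=> y0; rewrite /clamp max_r // min_l. Qed.

Lemma clamp_id y : 0 <= y <= 1 -> clamp y = y.
Proof. by move=> /andP[y0 y1]; rewrite /clamp max_l // min_l. Qed.

Lemma clamp_ge1 y : 1 <= y -> clamp y = 1.
Proof. by move=> y1; rewrite /clamp max_l ?min_r // (le_trans _ y1). Qed.

Lemma compl_segment x b : 0 < b -> b < x -> x + b < 1 ->
  [set y | b < `|x - y|] =
  (`]-oo, 0] `|` `]0, (x - b)[) `|` (`](x + b), 1] `|` `]1, +oo[) :> set R.
Proof.
move=> b0 bx xb; apply/seteqP; split => y /=; rewrite !in_itv /= ltr_normr ?andbT.
  move=> /orP[h|h]; [left|right].
    have [y0|y0] := leP y 0; [by left|right].
    by apply/andP; split => //; lra.
  have [y1|y1] := leP y 1; [left|by right].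
  by apply/andP; split => //; lra.
move=> [[h|/andP[h1 h2]]|[/andP[h1 h2]|h]]; apply/orP.
- by left; lra.
- by left; lra.
- by right; lra.
- by right; lra.
Qed.

Lemma fraclap_trunc_clamp s w F x : 0 < s -> pv_fraclap s w F -> w 0 = 0 ->
  w y @[y --> 0^'+] --> 0 -> (forall y, 0 < y -> w z @[z --> y] --> w y) ->
  0 < x < 1 ->
  fraclap_trunc s (fun z => w (clamp z)) x b @[b --> 0^'+] --> F x.
Proof.
move=> s0 pv w0 cw0 cw x01; have /andP[x0 x1] := x01.
have [Gm [Gp [[Gm0 cGm] dGm dGp cG eF]]] := pv _ x01.
pose u z := w (clamp z); pose a := 1 + 2 * s.
pose k y := (u x - u y) / `|x - y| `^ a.
have ux : u x = w x by rewrite /u clamp_id // !ltW.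
(* Since [Gm 0 = 0], the integrals over []0, x - b[] and [](x + b), 1]] add up to
   [Gm (x - b) - Gp (x + b) + Gp 1]. With the two tails, the truncated integral equals
   [Gm (x - b) - Gp (x + b) + F x] for every small [b]. *)
have h : (Gm (x - b) - Gp (x + b)) + F x @[b --> 0^'+] --> 0 + F x.
  by apply: cvgD => //; exact: cvg_cst.
rewrite add0r in h; apply: cvg_trans h; apply: near_eq_cvg; near=> b.
have b0 : 0 < b by [].
have bx : b < x by near: b; exact: nbhs_right_lt.
have xb : x + b < 1.
  rewrite addrC -ltrBrDr; near: b; apply: nbhs_right_lt; first by rewrite subr_gt0.
have dk y : y < x -> D1 (fun y => (x - y) `^ (- a)) y (- a * (x - y) `^ (- a - 1) * (- 1)).
  move=> yx; have h : 0 < x - y by rewrite subr_gt0.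
  apply: D1_eq (@D1_comp _ (fun z => z `^ (- a)) (fun y => x - y) _ _ _
   (D1_pow _ h) (D1_sub (D1_cst x y) (D1_id y))) _; by rewrite sub0r.
have dk' y : x < y -> D1 (fun y => (y - x) `^ (- a)) y (- a * (y - x) `^ (- a - 1) * 1).
  move=> yx; have h : 0 < y - x by rewrite subr_gt0.
  apply: D1_eq (@D1_comp _ (fun z => z `^ (- a)) (fun y => y - x) _ _ _
   (D1_pow _ h) (D1_sub (D1_id y) (D1_cst x y))) _; by rewrite subr0.
have ckm y : 0 < y < x ->
    (w x - w z) * (x - z) `^ (- a) @[z --> y] --> (w x - w y) * (x - y) `^ (- a).
  move=> /andP[y0 yx]; apply: cvgM; last exact: D1_cont (dk _ yx).
  by apply: cvgB; [exact: cvg_cst|exact: cw].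
have ckp y : x < y ->
    (w x - w z) * (z - x) `^ (- a) @[z --> y] --> (w x - w y) * (y - x) `^ (- a).
  move=> xy; apply: cvgM; last exact: D1_cont (dk' _ xy).
  by apply: cvgB; [exact: cvg_cst|apply: cw; exact: lt_trans xy].
have i1 : has_integral `]-oo, 0] k (w x * (x `^ (- (2 * s)) / (2 * s))).
  apply: has_integral_eq (has_integralZ (w x) (has_integral_tailN s0 x0)) => y /=.
  rewrite in_itv /= => y0; rewrite /k ux /u (clamp_le0 y0) w0 subr0.
  by rewrite gtr0_norm -?powRN // subr_gt0 (le_lt_trans y0).
have i4 : has_integral `]1, +oo[ k ((w x - w 1) * ((1 - x) `^ (- (2 * s)) / (2 * s))).
  apply: has_integral_eq (has_integralZ (w x - w 1)
    (has_integral_oy (has_integral_tail s0 x1))) => y /=.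
  rewrite in_itv /= andbT => y1; rewrite /k ux /u (clamp_ge1 (ltW y1)) -powRN.
  by rewrite ltr0_norm ?opprB // subr_lt0 (lt_trans x1).
have i2 : has_integral `]0, (x - b)[ k (Gm (x - b) - Gm 0).
  have xb0 : 0 < x - b by rewrite subr_gt0.
  have xbx : 0 < x - b < x by rewrite xb0 /= gtrBl.
  have sub y : 0 < y < x - b -> 0 < y < x.
    by move=> /andP[-> /=] h; apply: lt_trans h _; rewrite gtrBl.
  apply: (@has_integral_eq _ (fun y => (w x - w y) * (x - y) `^ (- a))).
    move=> y /=; rewrite in_itv /= => /sub /andP[y0 yx].
    rewrite /k ux /u clamp_id ?(ltW y0) ?(ltW (lt_trans yx x1)) //.
    by rewrite gtr0_norm ?subr_gt0 // powRN.
  apply: has_integral_oo; apply: has_integral_oc; apply: has_integral_seg => //.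
  - apply/(continuous_within_itvP _ xb0); split.
    + by move=> y; rewrite in_itv /= => /sub; exact: ckm.
    + apply: cvgM; last exact: cvg_at_right_filter (D1_cont (dk _ x0)).
      by apply: cvgB; [exact: cvg_cst|rewrite w0].
    + by apply: cvg_at_left_filter; exact: ckm.
  - by move=> y /sub; exact: dGm.
  - by rewrite Gm0.
  - exact: cvg_at_left_filter (D1_cont (dGm _ xbx)).
have i3 : has_integral `](x + b), 1] k (Gp 1 - Gp (x + b)).
  have xxb : x < x + b by rewrite ltrDl.
  apply: (@has_integral_eq _ (fun y => (w x - w y) * (y - x) `^ (- a))).
    move=> y /=; rewrite in_itv /= => /andP[y0 y1].
    have xy := lt_trans xxb y0.
    rewrite /k ux /u clamp_id ?y1 ?(ltW (lt_trans x0 xy)) //.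
    by rewrite ltr0_norm ?subr_lt0 // opprB powRN.
  apply: has_integral_oc; apply: has_integral_seg => //.
  - apply: continuous_in_subspaceT => y; rewrite inE /= in_itv /= => /andP[y0 _].
    by apply: ckp; exact: lt_le_trans y0.
  - by move=> y /andP[y0 _]; apply: dGp; exact: lt_trans y0.
  - exact: cvg_at_right_filter (D1_cont (dGp _ xxb)).
  - exact: cvg_at_left_filter (D1_cont (dGp _ x1)).
have d12 : `]-oo, 0] `&` `]0, (x - b)[ `<=` (set0 : set R).
  by move=> y [/=]; rewrite !in_itv /= => h /andP[h' _]; move: h'; rewrite ltNge h.
have d34 : `](x + b), 1] `&` `]1, +oo[ `<=` (set0 : set R).
  by move=> y [/=]; rewrite !in_itv /= andbT => /andP[_ h]; rewrite ltNge h.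
have [_ _ e] : has_integral [set y | b < `|x - y|] k
   ((w x * (x `^ (- (2 * s)) / (2 * s)) + (Gm (x - b) - Gm 0)) +
    ((Gp 1 - Gp (x + b)) + (w x - w 1) * ((1 - x) `^ (- (2 * s)) / (2 * s)))).
  rewrite compl_segment //; apply: has_integralU; [|exact: has_integralU|exact: has_integralU].
  move=> y [/=]; rewrite !in_itv /= andbT => h1 h2.
  have : y < x by case: h1 => [h|/andP[_ h]]; lra.
  by case: h2 => [/andP[h _]|h]; lra.
rewrite -[RHS]/(\int[mu]_(y in [set y | b < `|x - y|]) k y) e.
by rewrite eF Gm0; ring.
Unshelve. all: by end_near. Qed.

End lebesgue.

(** * Positivity of the normalizing constant *)

Section gamma.
Context {R : realType}.
Set Implicit Arguments.
Unset Strict Implicit.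
Unset Printing Implicit Defensive.
Implicit Types (f g h w F G : R -> R) (a b c d x y z t s M N e v : R).

Notation mu := (@lebesgue_measure R).

Lemma bigcup_segment : \bigcup_n `[(n.+2%:R^-1 : R), n.+2%:R]%classic = `]0, +oo[%classic.
Proof.
apply/seteqP; split => t /=.
  move=> [n _ /=]; rewrite !in_itv /= andbT => /andP[h _]; apply: lt_le_trans h.
  by rewrite invr_gt0.
rewrite in_itv /= andbT => t0.
pose m := Num.max t t^-1; pose n := Num.trunc m.
have m0 : 0 <= m by rewrite le_max (ltW t0).
have mn : m < n.+2%:R.
  have /andP[_ h] := truncn_itv m0.
  by apply: lt_trans h _; rewrite ltr_nat.
exists n => //=; rewrite in_itv /=; apply/andP; split; last first.
  by apply/ltW; apply: le_lt_trans mn; rewrite le_max lexx.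
rewrite invf_ple ?posrE //; apply/ltW; apply: le_lt_trans mn.
by rewrite le_max lexx orbT.
Qed.

Definition gamma_integrand z t : R := t `^ (z - 1) * expR (- t).

Lemma D1_expN t c : D1 (fun t => expR (c * t)) t (c * expR (c * t)).
Proof.
have h : D1 expR (c * t) (expR (c * t)) by exact: is_derive_expR.
apply: D1_eq (@D1_comp _ _ (fun t => c * t) _ _ _ h (D1_scale c (D1_id t))) _.
by rewrite mulr1 mulrC.
Qed.

Lemma gamma_integrand_cont z t : 0 < t ->
  gamma_integrand z y @[y --> t] --> gamma_integrand z t.
Proof.
move=> t0; have := D1_cont (D1_mul (D1_pow (z - 1) t0) (D1_expN t (- 1))).
rewrite /gamma_integrand mulN1r; apply: cvg_trans; apply: near_eq_cvg.
by near=> y; rewrite mulN1r.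
Unshelve. all: by end_near. Qed.

Lemma gamma_integrand_gt0 z t : 0 < t -> 0 < gamma_integrand z t.
Proof. by move=> t0; rewrite mulr_gt0 ?powR_gt0 ?expR_gt0. Qed.

(** Origin of the bound, uniform in [n]: up to [1] the integrand is at most [t^(z - 1)], which
    contributes [z^-1]. Beyond [1], [z <= 2] gives [t^(z - 1) <= t], and [t expR (- t / 2) <= 2]
    leaves [2 expR (- t / 2)], which contributes [4]. *)
Lemma gamma_segment z n : 0 < z -> z <= 2 -> exists v,
  [/\ 0 < v, v <= z^-1 + 4 &
    has_integral `[n.+2%:R^-1 : R, n.+2%:R] (gamma_integrand z) v].
Proof.
move=> z0 z2; pose a : R := n.+2%:R^-1; pose b : R := n.+2%:R.
have b1 : 1 < b by rewrite /b ltr1n.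
have a0 : 0 < a by rewrite invr_gt0.
have a1 : a < 1 by rewrite invf_lt1.
have ab : a < b by exact: lt_trans b1.
have cf t : 0 < t < b + 1 -> gamma_integrand z y @[y --> t] --> gamma_integrand z t.
  by move=> /andP[t0 _]; exact: gamma_integrand_cont.
have [G dG] := primitive_oo cf.
have sub t : a <= t <= b -> 0 < t < b + 1.
  by move=> /andP[at_ tb]; rewrite (lt_le_trans a0 at_) /=; lra.
have lo : G 1 - G a <= z^-1.
  suff : 1 / z * a `^ z - G a <= 1 / z * 1 `^ z - G 1.
    have : 0 <= 1 / z * a `^ z by rewrite mulr_ge0 ?powR_ge0 // divr_ge0 // ltW.
    by rewrite powR1 mulr1 div1r; lra.
  apply: (@le_D1_ge0 _ (fun t => 1 / z * t `^ z - G t)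
     (fun t => 1 * t `^ (z - 1) - gamma_integrand z t)); first exact: ltW.
    move=> t /andP[at_ t1]; have t0 := lt_le_trans a0 at_.
    apply: D1_sub; first by apply: D1_powscale => //; rewrite gt_eqF.
    by apply: dG; rewrite t0 /=; lra.
  move=> t /andP[at_ t1]; rewrite mul1r subr_ge0 /gamma_integrand.
  rewrite ler_piMr ?powR_ge0 // -expR0 ler_expR oppr_le0 ltW //.
  exact: lt_trans at_.
have hi : G b - G 1 <= 4.
  suff : - 4 * expR (- (1 / 2) * 1) - G 1 <= - 4 * expR (- (1 / 2) * b) - G b.
    have := expR_gt0 (- (1 / 2) * b).
    have : expR (- (1 / 2) * 1) <= (1 : R) by rewrite -[leRHS]expR0 ler_expR; lra.
    by lra.
  apply: (@le_D1_ge0 _ (fun t => - 4 * expR (- (1 / 2) * t) - G t)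
     (fun t => - 4 * (- (1 / 2) * expR (- (1 / 2) * t)) - gamma_integrand z t)); first exact: ltW.
    move=> t /andP[t1 tb]; apply: D1_sub; first by apply: D1_scale; exact: D1_expN.
    by apply: dG; rewrite (lt_le_trans _ t1) //=; lra.
  move=> t /andP[t1 tb]; have t0 : 0 < t by exact: lt_trans t1.
  rewrite subr_ge0 /gamma_integrand.
  have -> : - t = - (1 / 2) * t + - (1 / 2) * t by field.
  rewrite expRD mulrA; have := expR_gt0 (- (1 / 2) * t).
  have h1 : t `^ (z - 1) <= t.
    by rewrite -[leRHS](pow_1 t0); apply: ler_powR; [exact: ltW|lra].
  have h2 : 1 / 2 * t <= expR (1 / 2 * t).
    by apply: le_trans (expR_ge1Dx _); rewrite lerDr.
  have h3 : expR (- (1 / 2) * t) * expR (1 / 2 * t) = 1.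
    by rewrite -expRD -[RHS]expR0; congr expR; field.
  move: (expR (- (1 / 2) * t)) (expR (1 / 2 * t)) h2 h3 => E E' h2 h3 E0.
  have h4 : t * E <= 2.
    have : (1 / 2 * t) * E <= E' * E by rewrite ler_pM2r.
    by rewrite [E' * E]mulrC h3; lra.
  have : t `^ (z - 1) * E <= 2 by apply: le_trans h4; rewrite ler_pM2r.
  move=> h5; have : t `^ (z - 1) * E * E <= 2 * E by rewrite ler_pM2r.
  by lra.
exists (G b - G a); split.
- have hD t : t \in `]a, b[ -> is_derive t 1 G (gamma_integrand z t).
    by rewrite in_itv /= => /andP[h1 h2]; apply: dG; apply: sub; rewrite !ltW.
  have cG : {within `[a, b], continuous G}.
    by apply: (@D1_within _ a b G (gamma_integrand z)) => t /sub; exact: dG.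
  have [c] := MVT ab hD cG; rewrite in_itv /= => /andP[ac _] ->.
  by rewrite mulr_gt0 ?subr_gt0 // gamma_integrand_gt0 // (lt_trans a0).
- by lra.
apply: has_integral_seg => //.
- apply: continuous_in_subspaceT => t; rewrite inE /= in_itv /= => /sub /andP[t0 _].
  exact: gamma_integrand_cont.
- by move=> t /andP[h1 h2]; apply: dG; apply: sub; rewrite !ltW.
- by apply: cvg_at_right_filter; apply: D1_cont (dG _ _); apply: sub; rewrite lexx ltW.
- by apply: cvg_at_left_filter; apply: D1_cont (dG _ _); apply: sub; rewrite lexx ltW.
Qed.

(** A real-valued integral is [0] by default when the extended one is infinite, so positivity also
    requires finiteness: the lower bound comes from one segment, the upper one from monotone
    convergence. The range up to [2] covers both arguments in [fraclap_const]. *)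
Lemma Gamma_gt0 z : 0 < z -> z <= 2 -> 0 < Gamma z.
Proof.
move=> z0 z2; rewrite /Gamma -bigcup_segment.
pose S n : set (measurableTypeR R) := `[n.+2%:R^-1, n.+2%:R]%classic.
rewrite -[X in 0 < X]/(\int[mu]_(t in \bigcup_n S n) gamma_integrand z t).
have e n : exists v, [/\ 0 < v, v <= z^-1 + 4 &
    (\int[mu]_(t in S n) (gamma_integrand z t)%:E)%E = v%:E].
  have [v [v0 vC [_ i e]]] := gamma_segment n z0 z2; exists v; split => //.
  by rewrite -e /Rintegral fineK //; exact: integrable_fin_num.
have nd : nondecreasing_seq S.
  move=> m n mn; apply/subsetPset; apply: subset_itv; rewrite bnd_simp.
    by rewrite lef_pV2 ?posrE // ler_nat.
  by rewrite ler_nat.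
have mS n : measurable (S n) by exact: measurable_itv.
have f0 n t : S n t -> (0 <= (gamma_integrand z t)%:E)%E.
  by move=> _; rewrite lee_fin mulr_ge0 ?powR_ge0 ?expR_ge0.
have mf n : measurable_fun (S n) (EFin \o gamma_integrand z).
  by have [v [_ _ [_ i _]]] := gamma_segment n z0 z2; exact: (measurable_int mu).
have cv : (\int[mu]_(t in S n) (EFin \o gamma_integrand z) t @[n --> \oo] -->
    \int[mu]_(t in \bigcup_n S n) (EFin \o gamma_integrand z) t)%E.
  exact: ge0_nondecreasing_set_cvg_integral.
have nd' : nondecreasing_seq (fun n => \int[mu]_(t in S n) (EFin \o gamma_integrand z) t)%E.
  exact: ge0_nondecreasing_set_nondecreasing_integral.
rewrite /Rintegral; set I := (\int[mu]_(t in \bigcup_n S n) _)%E in cv *.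
have up : (I <= (z^-1 + 4)%:E)%E.
  rewrite -(cvg_lim _ cv) //; apply: lime_le; first by apply/cvg_ex; exists I.
  by near=> n; have [v [_ h ->]] := e n; rewrite lee_fin.
have [v [v0 _ ev]] := e 0%N.
have lo : (v%:E <= I)%E.
  rewrite -(cvg_lim _ cv) // -ev; apply: lime_ge; first by apply/cvg_ex; exists I.
  by near=> n; exact: nd'.
move: up lo; case: I {cv} => [r| |] //=.
by rewrite !lee_fin => _; exact: lt_le_trans.
Unshelve. all: by end_near. Qed.

Lemma fraclap_const_gt0 s : 0 < s -> s < 1 -> 0 < fraclap_const s.
Proof.
move=> s0 s1; rewrite /fraclap_const; apply: mulr_gt0; last first.
  by rewrite mulr_gt0 // subr_gt0.
apply: divr_gt0.
  by apply: mulr_gt0; [exact: powR_gt0|apply: Gamma_gt0; lra].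
by apply: mulr_gt0; [rewrite sqrtr_gt0 pi_gt0|apply: Gamma_gt0; lra].
Qed.

End gamma.

(** * Regularity up to the boundary *)

Section regularity.
Context {R : realType}.
Set Implicit Arguments.
Unset Strict Implicit.
Unset Printing Implicit Defensive.
Implicit Types (f g h r w u F G : R -> R) (a b c d x y z t s M N e v gam : R).
Implicit Types (j k m n : nat) (D C : nat -> R -> R) (l : seq (R * {poly R})).

Lemma derive_chain m D u a b : (forall x, a < x < b -> u x = D 0%N x) ->
  (forall j x, (j < m)%N -> a < x < b -> D1 (D j) x (D j.+1 x)) ->
  forall j, (j <= m)%N -> forall x, a < x < b -> u^`(j)%classic x = D j x.
Proof.
move=> e dD; elim=> [|j IH] jm x xab; first by rewrite derive1n0 e.
rewrite derive1nS; apply: D1_derive1; apply: (@D1_on _ a b (D j)) => //.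
  by move=> y yab; rewrite IH // ltnW.
exact: dD.
Qed.

Lemma derivable_chain m D u a b : (forall x, a < x < b -> u x = D 0%N x) ->
  (forall j x, (j < m)%N -> a < x < b -> D1 (D j) x (D j.+1 x)) ->
  forall j, (j < m)%N -> forall x, a < x < b -> derivable u^`(j)%classic x 1.
Proof.
move=> e dD j jm x xab; apply: D1_derivable (D j.+1 x) _.
apply: (@D1_on _ a b (D j)) => //; last exact: dD.
by move=> y yab; rewrite (derive_chain e dD) // ltnW.
Qed.

Lemma symb_chain K N r : symb K N r -> exists D, [/\ D 0%N = r,
  forall j x, (j < K)%N -> 0 < x < 1 -> D1 (D j) x (D j.+1 x) &
  forall j, (j <= K)%N -> symb 0 (N - j%:R) (D j)].
Proof.
elim: K N r => [|K IH] N r hr.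
  by exists (fun=> r); split => // j; rewrite leqn0 => /eqP ->; rewrite subr0.
have h0 : symb 0 N r.
  by elim: K {IH} hr => [|K IHK] hr; [exact: symb_S|apply: IHK; exact: symb_S].
have [_ _ [r' [dr hr']]] := hr; have [D [D0 dD sD]] := IH _ _ hr'.
exists (fun j => if j is j'.+1 then D j' else r); split => //.
  by move=> [|j] x jK x01; [rewrite D0; exact: dr|exact: dD].
move=> [|j] jK; first by rewrite subr0.
have -> : N - j.+1%:R = N - 1 - j%:R by rewrite -natr1; ring.
exact: sD.
Qed.

Lemma bound_cvg0 h e M : 0 < e -> (forall x, 0 < x < 1 / 2 -> `|h x| <= M * x `^ e) ->
  h x @[x --> 0^'+] --> 0.
Proof.
move=> e0 hM; have c1 : M * x `^ e @[x --> 0^'+] --> M * 0.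
  by apply: cvgMr; exact: powR_cvg0.
have c2 : - (M * x `^ e) @[x --> 0^'+] --> - (M * 0) by exact: cvgN.
rewrite mulr0 in c1; rewrite mulr0 oppr0 in c2.
apply: squeeze_cvgr c2 c1; near=> x; rewrite -ler_norml; apply: hM.
by near: x; apply: near0; lra.
Unshelve. all: by end_near. Qed.

(** At [0] a remainder has no prescribed value and a power-log function takes a default one. The
    functions to which this is applied tend to [0] from the right, so [0] is the continuous
    choice. *)
Definition ext0 h x : R := if 0 < x then h x else 0.

Lemma ext0_continuous (c : R -> R) h : continuous c ->
  (forall x, 0 < x < 1 -> h y @[y --> x] --> h x) -> h x @[x --> 0^'+] --> 0 ->
  {within `[0, (1 / 2)], continuous (fun x => c x + ext0 h x)}.
Proof.
move=> cc ch h0; have half0 : 0 < 1 / 2 :> R by [].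
have cx x : 0 < x < 1 -> ext0 h y @[y --> x] --> ext0 h x.
  move=> x01; apply: (@cont_on _ 0 1 h) => //; last exact: ch.
  by move=> y /andP[y0 _]; rewrite /ext0 y0.
apply/(continuous_within_itvP _ half0); split.
- move=> x; rewrite in_itv /= => /half_lt1 x01.
  by apply: cvgD; [exact: cc|exact: cx].
- apply: cvgD; first exact: cvg_at_right_filter (cc 0).
  rewrite {2}/ext0 ltxx; apply: cvg_trans h0; apply: near_eq_cvg; near=> x.
  by rewrite /ext0 ifT.
- apply: cvgD; first exact: cvg_at_left_filter (cc _).
  by apply: cvg_at_left_filter; apply: cx; lra.
Unshelve. all: by end_near. Qed.

Section closed_chain.
Variables (m : nat) (C D : nat -> R -> R) (u : R -> R).
Hypothesis cC : forall j, (j <= m)%N -> continuous (C j).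
Hypothesis cD : forall j, (j <= m)%N -> forall x, 0 < x < 1 -> D j y @[y --> x] --> D j x.
Hypothesis D0 : forall j, (j <= m)%N -> D j x @[x --> 0^'+] --> 0.
Hypothesis eu : forall x, 0 <= x < 1 -> u x = C 0%N x + ext0 (D 0%N) x.
Hypothesis dCD : forall j x, (j < m)%N -> 0 < x < 1 ->
  D1 (fun x => C j x + D j x) x (C j.+1 x + D j.+1 x).

Let eu' x : 0 < x < 1 -> u x = C 0%N x + D 0%N x.
Proof. by move=> /andP[x0 x1]; rewrite eu ?(ltW x0) // /ext0 x0. Qed.

(** Each derivative is split into [C j], continuous across [0], and [D j], controlled for [0 < x]
    only but vanishing in the limit; the extension to the closed interval is then explicit. *)
Lemma closed_chain_boundary j : (j <= m)%N ->
  derivative_up_to_boundary 0 (1 / 2) j u (fun x => C j x + ext0 (D j) x).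
Proof.
move=> jm; split; first by apply: ext0_continuous; [exact: cC|exact: cD|exact: D0].
move=> x; rewrite in_itv /= => xh; rewrite /ext0 ifT; last by case/andP: xh.
by rewrite (derive_chain (D := fun j x => C j x + D j x) eu' dCD) // half_lt1.
Qed.

Lemma closed_chain_Cm : Cm_closed 0 (1 / 2) m u.
Proof.
split.
- apply: (@subspace_eq_continuous _ _ _ (fun x => C 0%N x + ext0 (D 0%N) x)).
    move=> x; rewrite inE /= in_itv /= => /andP[x0 xh]; rewrite /from_subspace eu // x0 /=.
    by apply: le_lt_trans xh _; lra.
  by apply: ext0_continuous; [exact: cC|exact: cD|exact: D0].
- move=> j x jm; rewrite in_itv /= => /half_lt1.
  exact: (derivable_chain (D := fun j x => C j x + D j x) eu' dCD).
- by move=> j jm; exists (fun x => C j x + ext0 (D j) x); exact: closed_chain_boundary.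
Qed.

End closed_chain.

(** A ratio [z / (a + b)] in [0, 1] is at most its power of exponent [gam <= 1]; add the cases
    [z = a] and [z = b]. *)
Lemma powR_subadd a b gam : 0 <= a -> 0 <= b -> 0 < gam -> gam <= 1 ->
  (a + b) `^ gam <= a `^ gam + b `^ gam.
Proof.
move=> a0 b0 g0 g1; have [->|an] := eqVneq a 0.
  by rewrite add0r powR0 ?gt_eqF // add0r.
have ab : 0 < a + b by rewrite ltr_wpDr // lt_neqAle eq_sym an.
have key z : 0 <= z -> z <= a + b -> z / (a + b) * (a + b) `^ gam <= z `^ gam.
  move=> z0 zab; have [->|zn] := eqVneq z 0; first by rewrite !mul0r powR_ge0.
  have zp : 0 < z / (a + b) by rewrite divr_gt0 // lt_neqAle eq_sym zn.
  have z1 : z / (a + b) <= 1 by rewrite ler_pdivrMr // mul1r.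
  have h : z / (a + b) <= (z / (a + b)) `^ gam.
    by apply: ger1_powR => //; rewrite zp.
  rewrite -[leRHS](_ : (z / (a + b)) `^ gam * (a + b) `^ gam = _).
    by rewrite ler_wpM2r // powR_ge0.
  by rewrite -powRM ?(ltW zp) ?(ltW ab) // divfK // gt_eqF.
have := lerD (key a a0 _) (key b b0 _); rewrite lerDl b0 lerDr a0 -mulrDl -mulrDl.
by rewrite divff ?gt_eqF // mul1r; apply.
Qed.

(** Integrating the bound on [dh] gives a multiple of [y^gam - x^gam], and subadditivity of the
    power turns this into [(y - x)^gam]. *)
Lemma ext0_holder h dh gam M : 0 < gam -> gam <= 1 ->
  (forall x, 0 < x < 1 -> D1 h x (dh x)) ->
  (forall x, 0 < x < 1 -> `|dh x| <= M * x `^ (gam - 1)) ->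
  h x @[x --> 0^'+] --> 0 ->
  forall x y, 0 <= x < 1 -> 0 <= y < 1 ->
  `|ext0 h x - ext0 h y| <= M / gam * `|x - y| `^ gam.
Proof.
move=> g0 g1 dD hM h0 x y.
wlog xy : x y / x <= y.
  move=> H x1 y1; case/orP: (le_total x y) => k; first exact: H.
  by rewrite distrC [`|x - y|]distrC; exact: H.
move=> /andP[x0 x1] /andP[y0 y1].
have hh : 0 < (1 / 2 : R) < 1 by lra.
have Mg : 0 <= M / gam.
  apply: divr_ge0; last exact: ltW.
  have := le_trans (normr_ge0 _) (hM _ hh).
  by rewrite pmulr_lge0 // powR_gt0.
rewrite distrC [`|x - y|]distrC [`|y - x|]ger0_norm ?subr_ge0 //.
have [y0'|y0'] := ltP 0 y; last first.
  have -> : y = 0 by apply/eqP; rewrite eq_le y0' y0.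
  have -> : x = 0 by apply/eqP; rewrite eq_le x0 (le_trans xy y0').
  by rewrite subrr normr0 mulr_ge0 // powR_ge0.
have [x0'|x0'] := ltP 0 x; last first.
  have -> : x = 0 by apply/eqP; rewrite eq_le x0 x0'.
  rewrite /ext0 ltxx y0' !subr0.
  have [l [hl hb]] := D1_bound_lim g0 ltr01 dD hM.
  have l0 : l = 0 by exact: (cvg_unique _ hl h0).
  by have := hb y; rewrite l0 subr0; apply; rewrite y0'.
rewrite /ext0 x0' y0'; apply: le_trans (D1_bound_diff g0 dD hM x0' xy y1) _.
rewrite ler_wpM2l // lerBlDl.
rewrite -{1}[y](subrK x) [_ + x]addrC.
by apply: powR_subadd; rewrite ?subr_ge0.
Qed.

(** Compare [x] with the boundary point [0], where the extension must equal [c]. Larger exponents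
    are excluded through this one consequence of the Hölder condition. *)
Lemma holder_boundary m gam c u h : (forall x, 0 < x < 1 / 2 -> u^`(m)%classic x = c + h x) ->
  h x @[x --> 0^'+] --> 0 -> holder_closed 0 (1 / 2) m gam u ->
  exists M, forall x, 0 < x < 1 / 2 -> `|h x| <= M * x `^ gam.
Proof.
move=> eu h0 [_ [g [[cg eg] [M hM]]]]; exists M => x xh.
have half0 : 0 < 1 / 2 :> R by [].
have [_ cg0 _] := (continuous_within_itvP _ half0).1 cg.
have g0 : g 0 = c.
  have h1 : c + h x @[x --> 0^'+] --> c + 0 by apply: cvgD => //; exact: cvg_cst.
  rewrite addr0 in h1; apply: (cvg_unique _ cg0) => //.
  apply: cvg_trans h1; apply: near_eq_cvg; near=> z.
  have zh : 0 < z < 1 / 2 by near: z; exact: near0.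
  by rewrite -eu // -eg // in_itv.
have /andP[x0 x1] := xh.
have i0 : 0 \in `[0, (1 / 2 : R)] by rewrite in_itv /= lexx ltW.
have i1 : x \in `[0, (1 / 2)] by rewrite in_itv /= !ltW.
have := hM _ _ i1 i0; rewrite g0 eg; last by rewrite in_itv.
rewrite eu // subr0 (_ : c + h x - c = h x); last by ring.
by rewrite (gtr0_norm x0).
Unshelve. all: by end_near. Qed.

Lemma plogs_cat l l' x : plogs (l ++ l') x = plogs l x + plogs l' x.
Proof. by rewrite /plogs big_cat. Qed.

Lemma plogs_bound N l : all (fun q : R * {poly R} => N < q.1) l ->
  exists M, 0 <= M /\ forall x, 0 < x < 1 -> `|plogs l x| <= M * x `^ N.
Proof.
elim: l => [|q l IH] /=.
  by exists 0; split => // x _; rewrite plogs_nil normr0 mul0r.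
move=> /andP[qN /IH [M [M0 hM]]].
have [M' [M'0 hM']] := plog_bound q.2 qN.
exists (M' + M); split; first exact: addr_ge0.
move=> x x01; rewrite plogs_cons (le_trans (ler_normD _ _)) // mulrDl.
by apply: lerD; [exact: hM'|exact: hM].
Qed.

Lemma plogs_cvg0 l : all (fun q : R * {poly R} => 0 < q.1) l ->
  plogs l x @[x --> 0^'+] --> 0.
Proof.
move=> hl; have [e [e0 he]] : exists e, 0 < e /\ all (fun q : R * {poly R} => e < q.1) l.
  elim: l hl => [|q l IH] /=; first by exists 1.
  move=> /andP[q0 /IH [e [e0 he]]]; exists (Num.min e (q.1 / 2)); split.
    by rewrite lt_min e0 /=; lra.
  rewrite gt_min; apply/andP; split; first by apply/orP; right; lra.
  by apply: sub_all he => t; apply: le_lt_trans; rewrite ge_min lexx.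
have [M [_ hM]] := plogs_bound he.
by apply: (@bound_cvg0 _ e M) => // x /half_lt1; exact: hM.
Qed.

Lemma plogs_cont l x : 0 < x -> plogs l y @[y --> x] --> plogs l x.
Proof. by move=> x0; exact: D1_cont (D1_plogs l x0). Qed.

Lemma dplogs_cat l l' : dplogs (l ++ l') = dplogs l ++ dplogs l'.
Proof. by rewrite /dplogs map_cat. Qed.

Lemma dplogs_exponent a l : all (fun q : R * {poly R} => a <= q.1) l ->
  all (fun q : R * {poly R} => a - 1 <= q.1) (dplogs l).
Proof. by rewrite /dplogs all_map; apply: sub_all => q /=; rewrite lerD2r. Qed.

Lemma exponent_lt a b l : b < a -> all (fun q : R * {poly R} => a <= q.1) l ->
  all (fun q : R * {poly R} => b < q.1) l.
Proof. by move=> ba; apply: sub_all => q; exact: lt_le_trans. Qed.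

Lemma clamp_continuous w : w 0 = 0 -> w y @[y --> 0^'+] --> 0 ->
  (forall y, 0 < y -> w z @[z --> y] --> w y) -> continuous (w \o @clamp R).
Proof.
move=> w0 cw0 cw.
have cc : continuous (@clamp R).
  move=> z; apply: (@continuous_min _ _ (fun y => Num.max y 0) (fun=> 1)).
    apply: (@continuous_max _ _ (fun y => y) (fun=> 0)); first exact: cvg_id.
    exact: cvg_cst.
  exact: cvg_cst.
move=> z; have [z0|z0|->] := ltgtP z 0.
- rewrite /continuous_at /= clamp_le0 ?ltW // w0.
  have h : (fun=> 0 : R) y @[y --> z] --> (0 : R) by exact: cvg_cst.
  apply: cvg_trans h; apply: near_eq_cvg; near=> y.
  rewrite /= clamp_le0 ?w0 // ltW //; near: y; exact: near_lt.
- apply: continuous_comp; first exact: cc.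
  by apply: cw; rewrite /clamp lt_min ltr01 andbT lt_max z0.
apply/left_right_continuousP; rewrite /= clamp_le0 // w0; split.
  have h : (fun=> 0 : R) y @[y --> (0 : R)^'-] --> (0 : R) by exact: cvg_cst.
  apply: cvg_trans h; apply: near_eq_cvg; near=> y.
  by rewrite /= clamp_le0 ?w0 // ltW.
apply: cvg_trans cw0; apply: near_eq_cvg; near=> y.
have /andP[y0 y1] : 0 < y < 1 by near: y; exact: near0.
by rewrite /= clamp_id // !ltW.
Unshelve. all: by end_near. Qed.

Lemma bounded_Lfun u M : continuous u -> (forall x, `|u x| <= M) ->
  u \in Lfun (@lebesgue_measure R) +oo%E.
Proof.
move=> cu hM; rewrite inE; apply/andP; split.
  by rewrite inE /=; exact: continuous_measurable_fun.
rewrite inE /= /finite_norm unlock /=.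
case: ifP => _; last by rewrite ltry.
apply: (@le_lt_trans _ _ M%:E); last exact: ltry.
by apply/ess_sup_inf.ess_supP; apply: nearW => x /=; rewrite lee_fin.
Qed.

End regularity.

(** * The leading singular term *)

Section boundary_regularity.
Context {R : realType}.
Set Implicit Arguments.
Unset Strict Implicit.
Unset Printing Implicit Defensive.
Implicit Types (f g h r w u F G : R -> R) (a b c d x y z t s M N e v gam kappa : R).
Implicit Types (j k m n : nat) (l : seq (R * {poly R})) (A Q : {poly R}).

Lemma iter_dplogs_exponent a j l : all (fun q : R * {poly R} => a <= q.1) l ->
  all (fun q : R * {poly R} => a - j%:R <= q.1) (iter j dplogs l).
Proof.
move=> hl; elim: j => [|j IH]; first by rewrite subr0.
rewrite iterS -natr1 opprD addrA; exact: dplogs_exponent.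
Qed.

Lemma plogs0 l : all (fun q : R * {poly R} => 0 < q.1) l -> plogs l 0 = 0.
Proof.
elim: l => [|q l IH] /=; first by rewrite plogs_nil.
by move=> /andP[q0 /IH]; rewrite plogs_cons /plog powR0 ?gt_eqF // mul0r add0r.
Qed.

Definition lin_part j : R -> R :=
  match j with 0%N => fun x => x | 1%N => fun=> 1 | _ => fun=> 0 end.

Lemma D1_lin_part j x : D1 (lin_part j) x (lin_part j.+1 x).
Proof. by case: j => [|[|j]]; [exact: D1_id|exact: D1_cst|exact: D1_cst]. Qed.

Section lin_plogs.
Variables (m : nat) (a : R) (l : seq (R * {poly R})) (u : R -> R).
Hypotheses (m0 : (0 < m)%N) (ma : m%:R < a).
Hypothesis hl : all (fun q : R * {poly R} => a <= q.1) l.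
Hypothesis eu : forall x, 0 <= x < 1 -> u x = x + ext0 (plogs l) x.

Let D j := plogs (iter j dplogs l).

Let D0 j : (j <= m)%N -> D j x @[x --> 0^'+] --> 0.
Proof.
move=> jm; apply: plogs_cvg0; apply: exponent_lt (iter_dplogs_exponent j hl).
by rewrite subr_gt0 (le_lt_trans _ ma) // ler_nat.
Qed.

Let cD j x : 0 < x < 1 -> D j y @[y --> x] --> D j x.
Proof. by move=> /andP[x0 _]; exact: plogs_cont. Qed.

Let dD j x : 0 < x < 1 ->
  D1 (fun x => lin_part j x + D j x) x (lin_part j.+1 x + D j.+1 x).
Proof.
move=> /andP[x0 _]; apply: D1_add; first exact: D1_lin_part.
by rewrite /D iterS; exact: D1_plogs.
Qed.

Let cC j : continuous (lin_part j).
Proof. by move=> x; exact: D1_cont (D1_lin_part j x). Qed.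

Lemma lin_plogs_holder gam M : 0 < gam -> gam <= 1 ->
  (forall x, 0 < x < 1 -> `|plogs (iter m.+1 dplogs l) x| <= M * x `^ (gam - 1)) ->
  holder_closed 0 (1 / 2) m gam u.
Proof.
move=> g0 g1 hM; split.
  apply: (@closed_chain_Cm _ m lin_part D) => //.
    by move=> j _ x; exact: cD.
  by move=> j x _; exact: dD.
exists (fun x => lin_part m x + ext0 (D m) x); split.
  apply: (@closed_chain_boundary _ m lin_part D) => //.
    by move=> j _ x; exact: cD.
  by move=> j x _; exact: dD.
exists (M / gam) => x y; rewrite !in_itv /= => /andP[x0 x1] /andP[y0 y1].
(* For [m >= 1] the derivative of order [m] of the linear part is constant and drops out of
   differences. *)
have -> : lin_part m x = lin_part m y by case: (m) m0 => [|[|?]].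
rewrite opprD addrACA subrr add0r; apply: ext0_holder (D0 _) _ _ _ _ => //.
- move=> z /andP[z0 _]; exact: D1_plogs.
- exact: hM.
- by rewrite x0 (le_lt_trans x1) //; lra.
- by rewrite y0 (le_lt_trans y1) //; lra.
Qed.

Lemma lin_plogs_holder_bound gam : holder_closed 0 (1 / 2) m gam u ->
  exists M, forall x, 0 < x < 1 / 2 -> `|plogs (iter m dplogs l) x| <= M * x `^ gam.
Proof.
apply: (@holder_boundary _ m gam (lin_part m 0)); last exact: D0.
move=> x /half_lt1 x01.
rewrite (@derive_chain _ m (fun j x => lin_part j x + D j x) u 0 1) //.
- by congr (_ + _); case: (m) m0 => [|[|?]].
- by move=> z /andP[z0 z1]; rewrite eu ?(ltW z0) // /ext0 z0.
- by move=> j z _; exact: dD.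
Qed.

End lin_plogs.

(** Dividing by [x^gam] leaves [|a| <= C x^(min d e)], which tends to [0]. *)
Lemma const_lead_absurd gam a d e M M' h : a != 0 -> 0 < d -> 0 < e ->
  (forall x, 0 < x < 1 -> `|h x| <= M * x `^ (gam + d)) ->
  (forall x, 0 < x < 1 / 2 -> `|h x + plog gam a%:P x| <= M' * x `^ (gam + e)) -> False.
Proof.
move=> a0 d0 e0 hM hM'; pose c := Num.min d e.
have c0 : 0 < c by rewrite lt_min d0 e0.
have key x : 0 < x < 1 / 2 -> `|a| <= (`|M| + `|M'|) * x `^ c.
  move=> xh; have x01 := half_lt1 xh; have x0 : 0 < x by case/andP: x01.
  have p0 : 0 < x `^ gam by exact: powR_gt0.
  rewrite -(ler_pM2r p0) -[`|a| * _](_ : `|plog gam a%:P x| = _); last first.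
    by rewrite /plog hornerC normrM [`|_ `^ _|]ger0_norm ?powR_ge0 // mulrC.
  have -> : plog gam a%:P x = (h x + plog gam a%:P x) - h x by ring.
  rewrite (le_trans (ler_normB _ _)) // addrC !mulrDl -!mulrA -!pow_split //.
  apply: lerD.
    apply: le_trans (hM _ x01) _; apply: (@le_trans _ _ (`|M| * x `^ (gam + d))).
      by rewrite ler_wpM2r ?powR_ge0 // ler_norm.
    by rewrite ler_wpM2l // pow_le1 // addrC lerD2l ge_min lexx.
  apply: le_trans (hM' _ xh) _; apply: (@le_trans _ _ (`|M'| * x `^ (gam + e))).
    by rewrite ler_wpM2r ?powR_ge0 // ler_norm.
  by rewrite ler_wpM2l // pow_le1 // addrC lerD2l ge_min lexx orbT.
have h0 : (`|M| + `|M'|) * x `^ c @[x --> 0^'+] --> (`|M| + `|M'|) * 0.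
  by apply: cvgMr; exact: powR_cvg0.
rewrite mulr0 in h0.
have : `|a| <= 0.
  apply: (cvgr_to_ge h0); near=> x; apply: key; near: x; apply: near0; lra.
by rewrite normr_le0 (negbTE a0).
Unshelve. all: by end_near. Qed.

Lemma log_lead_absurd kappa M M' h : 0 < kappa ->
  (forall x, 0 < x < 1 -> `|h x| <= M * x `^ 1) ->
  (forall x, 0 < x < 1 / 2 -> `|h x + plog 1 (kappa *: ('X - 1%:P)) x| <= M' * x `^ 1) ->
  False.
Proof.
move=> k0 hM hM'; pose c := `|M| + `|M'|; have c0 : 0 <= c by rewrite addr_ge0.
have key x : 0 < x < 1 / 2 -> `|kappa * (ln x - 1)| <= c.
  move=> xh; have x01 := half_lt1 xh; have x0 : 0 < x by case/andP: x01.
  have p0 : 0 < x `^ 1 by exact: powR_gt0.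
  rewrite -(ler_pM2r p0).
  rewrite -[`|kappa * _| * _](_ : `|plog 1 (kappa *: ('X - 1%:P)) x| = _); last first.
    rewrite /plog hornerZ hornerD hornerN hornerC hornerX normrM.
    by rewrite [`|_ `^ _|]ger0_norm ?powR_ge0 // mulrC.
  have -> : plog 1 (kappa *: ('X - 1%:P)) x = (h x + plog 1 (kappa *: ('X - 1%:P)) x) - h x by ring.
  rewrite (le_trans (ler_normB _ _)) // addrC mulrDl.
  apply: lerD.
    by apply: le_trans (hM _ x01) _; rewrite ler_wpM2r ?powR_ge0 // ler_norm.
  by apply: le_trans (hM' _ xh) _; rewrite ler_wpM2r ?powR_ge0 // ler_norm.
(* At [x = expR (- t)] the left-hand side of [key] is [c + 3 * kappa > c]; the summand [2] ensures
   [x < 1 / 2]. *)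
pose t := c / kappa + 2.
have t2 : 2 <= t by rewrite /t lerDr divr_ge0 // ltW.
have xh : 0 < expR (- t) < 1 / 2.
  rewrite expR_gt0 /= expRN div1r ltf_pV2 ?posrE ?expR_gt0 //.
  by apply: lt_le_trans (expR_ge1Dx _); lra.
have := key _ xh; rewrite expRK ltr0_norm; last first.
  by rewrite pmulr_rlt0 //; lra.
have -> : - (kappa * (- t - 1)) = c + 3 * kappa.
  by rewrite /t; field; rewrite gt_eqF.
by lra.
Qed.

Lemma leading_terms s kappa Q : s < 1 ->
  (s != 1 / 2 -> Q = (2 * s * (1 - 2 * s))^-1%:P) -> (s = 1 / 2 -> Q = 'X) ->
  exists Q1 A, [/\ (3 - 2 * s) *: Q1 + Q1^`() = A, (2 - 2 * s) *: A + A^`() = kappa *: Q,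
    s != 1 / 2 -> A = (kappa * (2 * s * (1 - 2 * s))^-1 / (2 - 2 * s))%:P &
    s = 1 / 2 -> A = kappa *: ('X - 1%:P)].
Proof.
move=> s1 h1 h2; have [sh|sh] := eqVneq s (1 / 2).
  have -> : 3 - 2 * s = 2 by rewrite sh; field.
  have -> : 2 - 2 * s = 1 by rewrite sh; field.
  (* Successive primitives of [ln x]: first [x ln x - x], then [x^2 (ln x / 2 - 3 / 4)]. *)
  exists (kappa *: ((1 / 2) *: 'X - (3 / 4)%:P)), (kappa *: ('X - 1%:P)); split => //.
  - rewrite derivZ derivB derivZ derivX derivC subr0; apply/polyP => i.
    rewrite !(coefD, coefZ, coefN, coefX, coefC, coef1).
    by case: i => [|[|i]] /=; field.
  - rewrite h2 // derivZ derivB derivX derivC subr0 scale1r -scalerDr.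
    by rewrite subrK.
set c := (2 * s * (1 - 2 * s))^-1.
have n1 : 2 - 2 * s != 0 by rewrite gt_eqF //; lra.
have n2 : 3 - 2 * s != 0 by rewrite gt_eqF //; lra.
exists (kappa * c / (2 - 2 * s) / (3 - 2 * s))%:P, (kappa * c / (2 - 2 * s))%:P; split => //.
- rewrite derivC addr0 -mul_polyC -polyCM; congr _%:P.
  by rewrite mulrC divfK.
- rewrite derivC addr0 h1 // -!mul_polyC -!polyCM; congr _%:P.
  by rewrite mulrC divfK.
- by move=> e; rewrite e eqxx in sh.
Qed.

End boundary_regularity.

(** * The solution *)

Section solution.
Context {R : realType}.
Set Implicit Arguments.
Unset Strict Implicit.
Unset Printing Implicit Defensive.
Implicit Types (l : seq (R * {poly R})) (A Q : {poly R}).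

Lemma expansion_Cm_closed (P : {poly R}) (r : R -> R) k N : k%:R < N -> symb k N r ->
  Cm_closed 0 (1 / 2) k (fun x => P.[x] + ext0 r x).
Proof.
move=> kN hr; have [D [D0 dD sD]] := symb_chain hr.
apply: (@closed_chain_Cm _ k (fun j x => P^`(j).[x]) D).
- by move=> j _; exact: continuous_horner.
- by move=> j jk x x01; have := symb_cont (sD _ jk); exact.
- move=> j jk; have [M [_ hM]] := symb_bound (sD _ jk).
  apply: bound_cvg0 hM; rewrite subr_gt0; apply: le_lt_trans kN.
  by rewrite ler_nat.
- by move=> x _; rewrite D0.
move=> j x jk x01; apply: D1_add; last exact: dD.
by rewrite derivnS; exact: D1_horner.
Qed.

(** The expansion of [u] is exposed because its exact regularity is read off from it alone: [B] is
    the polynomial of the leading singular term of [u'], at exponent [2 - 2 s]. *)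
Lemma expansion_solution (s : R) k : 0 < s -> s < 1 ->
  exists (l : seq (R * {poly R})) (A Q : {poly R}) (f u : R -> R),
  let L := l ++ [:: (3 - 2 * s, A)] in
  let B := (3 - 2 * s) *: A + A^`() in
  [/\ all (fun q => 5 - 4 * s <= q.1) l,
      (2 - 2 * s) *: B + B^`() = fraclap_const s *: Q,
      (s != 1 / 2 -> exists2 b : R, b != 0 & B = b%:P) /\
      (s = 1 / 2 -> B = fraclap_const s *: ('X - 1%:P)),
      (forall x, 0 <= x < 1 -> u x = x + ext0 (plogs L) x) &
      [/\ Cm_closed 0 (1 / 2) k f,
        [/\ u \in Lfun (@lebesgue_measure R) +oo%E,
            continuous u & Cinfty_open 0 1 u],
        (forall x : R, 0 < x < 1 / 2 ->
           fraclap_defined s u x /\ - u^`(2)%classic x + fraclap s u x = f x) &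
        (forall x : R, x <= 0 -> u x = 0)]].
Proof.
move=> s0 s1; set kappa := fraclap_const s.
have k0 : 0 < kappa by exact: fraclap_const_gt0.
have [F0 [Q0 [pv0 t0 hne heq]]] := pv_fraclap_id s0 s1.
have [Q1 [B [eB eQ0 Bne Beq]]] := leading_terms kappa s1 hne heq.
(* With this number of corrections the last exponent [q] exceeds [k + 3], since [1 - 2 s > -1]; the
   remaining singular term is therefore of order [k + 1] together with its derivatives up to order
   [k]. *)
pose j := Num.trunc ((k%:R + 4) / (2 - 2 * s)).
have s2 : 0 < 2 - 2 * s by lra.
have kR0 : 0 <= k%:R :> R by [].
have jb : k%:R + 4 < (2 - 2 * s) * j.+1%:R.
  rewrite mulrC -ltr_pdivrMr //.
  have h : 0 <= (k%:R + 4) / (2 - 2 * s) by rewrite divr_ge0 ?(ltW s2) //; lra.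
  by case/andP: (truncn_itv h).
have [l [Q [P [r [F [hl pvL hr eF]]]]]] :=
  correction k (k%:R + 1) j s0 s1 pv0 t0 eB eQ0.
pose w := plogs (l ++ [:: (3 - 2 * s, Q1); (1, 1%:P)]).
have hL : all (fun q : R * {poly R} => 0 < q.1) (l ++ [:: (3 - 2 * s, Q1); (1, 1%:P)]).
  rewrite all_cat (exponent_lt _ hl) /=; last by lra.
  by rewrite ltr01 andbT; lra.
have w0 : w 0 = 0 by exact: plogs0.
have cw0 : w y @[y --> 0^'+] --> 0 by exact: plogs_cvg0.
have cw (y : R) : 0 < y -> w z @[z --> y] --> w y by exact: plogs_cont.
pose u := w \o @clamp R.
pose q := 1 - 2 * s + (2 - 2 * s) * j.+1%:R.
pose sg (x : R) := r x + plog q Q x.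
have hsg : symb k (k%:R + 1) sg.
  by apply: symb_add => //; apply: symb_plog; rewrite /q; lra.
have uw (x : R) : 0 < x < 1 -> u x = w x.
  by move=> /andP[x0 x1]; rewrite /u /= clamp_id // !ltW.
have dW m x : 0 < x < 1 -> D1 (plogs (iter m dplogs (l ++ [:: (3 - 2 * s, Q1); (1, 1%:P)]))) x
    (plogs (iter m.+1 dplogs (l ++ [:: (3 - 2 * s, Q1); (1, 1%:P)])) x).
  by move=> /andP[x0 _]; rewrite iterS; exact: D1_plogs.
have du m : forall x : R, 0 < x < 1 -> u^`(m)%classic x =
    plogs (iter m dplogs (l ++ [:: (3 - 2 * s, Q1); (1, 1%:P)])) x.
  apply: (derive_chain (m := m) (D := fun m =>
    plogs (iter m dplogs (l ++ [:: (3 - 2 * s, Q1); (1, 1%:P)])))) => //.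
  by move=> i x _; exact: dW.
have cu : continuous u by exact: clamp_continuous.
exists l, Q1, Q0, (fun x => P.[x] + ext0 sg x), u; split => //.
- by rewrite eB.
- split; last by rewrite eB.
  move=> sh; rewrite eB Bne //; eexists; last by [].
  have h1 : 1 - 2 * s != 0 by apply: contra_neq sh; lra.
  have h2 : 2 * s != 0 by rewrite gt_eqF //; lra.
  apply: mulf_neq0; last by rewrite invr_eq0 gt_eqF.
  apply: mulf_neq0; first by rewrite gt_eqF.
  by rewrite invr_eq0 mulf_neq0.
- move=> x /andP[x0 x1]; rewrite /u /= clamp_id ?x0 ?(ltW x1) //.
  have [x0'|x0'] := ltP 0 x.
    rewrite /ext0 x0' /w !plogs_cat !plogs_cons plogs_nil /= [plog 1 _ x]/plog.
    by rewrite hornerC pow_1 //; ring.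
  have -> : x = 0 by apply/eqP; rewrite eq_le x0 x0'.
  by rewrite w0 /ext0 ltxx addr0.
split.
- by apply: expansion_Cm_closed hsg; rewrite ltrDl.
- split => //.
  + have h01 : 0 < (1 / 2 : R) by [].
    have [M [M0 hM]] := plogs_bound hL.
    apply: (@bounded_Lfun _ u (M + `|w 1|)) => // x.
    have [x0|x0] := leP x 0.
      by rewrite /u /= clamp_le0 // w0 normr0 addr_ge0.
    have [x1|x1] := ltP x 1.
      rewrite uw ?x0 // (le_trans (hM x _)) ?x0 // powRr0 mulr1 lerDl.
      exact: normr_ge0.
    by rewrite /u /= clamp_ge1 // lerDr.
  + move=> m x; rewrite in_itv /=.
    apply: (derivable_chain (m := m.+1) (D := fun m =>
      plogs (iter m dplogs (l ++ [:: (3 - 2 * s, Q1); (1, 1%:P)])))) => //.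
    by move=> i y _; exact: dW.
- move=> x xh; have x01 := half_lt1 xh.
  have h := fraclap_trunc_clamp s0 pvL w0 cw0 cw x01.
  split; first by apply/cvg_ex; exists (F x).
  rewrite /fraclap (cvg_lim _ h) // du //.
  have := eF _ x01; rewrite -/q -/kappa => e.
  rewrite addrC e /sg /ext0 ifT; last by case/andP: x01.
  by rewrite addrA.
- by move=> x x0; rewrite /u /= clamp_le0.
Qed.

End solution.

Theorem theorem1p2 (R : realType) (s : R) (hs0 : 0 < s) (hs1 : s < 1)
    (k : nat) (hk : (0 < k)%N) :
  exists f u : R -> R,
    [/\ Cm_closed 0 (1 / 2) k f,
        [/\ u \in Lfun (@lebesgue_measure R) +oo%E,
            continuous u & Cinfty_open 0 1 u],
        (forall x : R, 0 < x < 1 / 2 ->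
           fraclap_defined s u x /\ - u^`(2)%classic x + fraclap s u x = f x),
        (forall x : R, x <= 0 -> u x = 0) &
        [/\ s < 1 / 2 ->
              (holder_closed 0 (1 / 2) 2 (1 - 2 * s) `\`
               \bigcup_(e in [set e : R | 0 < e /\ 0 < 1 - 2 * s + e <= 1])
                 holder_closed 0 (1 / 2) 2 (1 - 2 * s + e)) u,
            s = 1 / 2 ->
              (\bigcap_(e in [set e : R | 0 < e /\ 0 < 1 - e <= 1])
                 holder_closed 0 (1 / 2) 1 (1 - e) `\`
               holder_closed 0 (1 / 2) 1 1) u &
            1 / 2 < s ->
              (holder_closed 0 (1 / 2) 1 (2 - 2 * s) `\`
               \bigcup_(e in [set e : R | 0 < e /\ 0 < 2 - 2 * s + e <= 1])
                 holder_closed 0 (1 / 2) 1 (2 - 2 * s + e)) u]].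
Proof.
have [l [A [Q [f [u [hl eQ [Bne Beq] eu [hf hu hfu hu0]]]]]]] := expansion_solution k hs0 hs1.
exists f, u; split => //.
move: Bne Beq eQ; set B := (3 - 2 * s) *: A + A^`() => Bne Beq eQ.
have kap := fraclap_const_gt0 hs0 hs1.
pose L := l ++ [:: (3 - 2 * s, A)].
have e1 x : plogs (iter 1 dplogs L) x = plogs (dplogs l) x + plog (2 - 2 * s) B x.
  rewrite /= /L dplogs_cat plogs_cat plogs_cons plogs_nil addr0 /= -/B.
  by rewrite (_ : 3 - 2 * s - 1 = 2 - 2 * s) //; ring.
have e2 x : plogs (iter 2 dplogs L) x = plogs (iter 2 dplogs l) x +
    plog (1 - 2 * s) (fraclap_const s *: Q) x.
  rewrite /= /L !dplogs_cat plogs_cat plogs_cons plogs_nil addr0 /= -/B.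
  rewrite (_ : 3 - 2 * s - 1 = 2 - 2 * s); last by ring.
  by rewrite eQ (_ : 2 - 2 * s - 1 = 1 - 2 * s) //; ring.
have e3 x : plogs (iter 3 dplogs L) x = plogs (iter 3 dplogs l) x +
    plog (- 2 * s) ((1 - 2 * s) *: (fraclap_const s *: Q) + (fraclap_const s *: Q)^`()) x.
  rewrite /= /L !dplogs_cat plogs_cat plogs_cons plogs_nil addr0 /= -/B.
  rewrite (_ : 3 - 2 * s - 1 = 2 - 2 * s); last by ring.
  rewrite eQ (_ : 2 - 2 * s - 1 = 1 - 2 * s); last by ring.
  by rewrite (_ : 1 - 2 * s - 1 = - 2 * s) //; ring.
have rest m N : N < 5 - 4 * s - m%:R -> exists M, 0 <= M /\
    forall x, 0 < x < 1 -> `|plogs (iter m dplogs l) x| <= M * x `^ N.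
  by move=> mN; apply: plogs_bound; apply: exponent_lt mN _; exact: iter_dplogs_exponent.
(* A pure power is bounded with its own exponent, whereas [plogs_bound] loses a little to the
   logarithms. This gives the endpoint exponent in the positive statements for [s != 1 / 2]. *)
have const p c N M : N = p -> 0 <= M -> exists M', forall h : R -> R,
    (forall x, 0 < x < 1 -> `|h x| <= M * x `^ N) ->
    forall x, 0 < x < 1 -> `|h x + plog p c%:P x| <= M' * x `^ N.
  move=> -> M0; exists (M + `|c|) => h hM x x01.
  rewrite (le_trans (ler_normD _ _)) // mulrDl; apply: lerD; first exact: hM.
  by rewrite /plog hornerC normrM [`|_ `^ _|]ger0_norm ?powR_ge0 // mulrC.
have n22 : 0 < 2 - 2 * s by lra.
have Qc b : B = b%:P -> fraclap_const s *: Q = ((2 - 2 * s) * b)%:P.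
  by move=> eb; rewrite -eQ eb derivC addr0 -mul_polyC -polyCM.
(* The leading term [x^(3 - 2 s)] is tested on [u''] for [s < 1 / 2] and on [u'] otherwise.
   Membership follows from a bound on the next derivative, non-membership from the size of the
   tested derivative near [0]. *)
split.
- move=> sh; have [b b0 eb] : exists2 b : R, b != 0 & B = b%:P by apply: Bne; rewrite lt_eqF.
  have eQ' := Qc _ eb.
  have L2 : all (fun q : R * {poly R} => 3 - 2 * s <= q.1) L.
    rewrite all_cat /= lexx /= andbT; apply: sub_all hl => q; apply: le_trans; lra.
  have m2 : 2%:R < 3 - 2 * s by lra.
  have [M [M0 hM]] := rest 3%N (- 2 * s) ltac:(lra).
  have [M' hM'] := const (- 2 * s) ((1 - 2 * s) * ((2 - 2 * s) * b)) (- 2 * s) M erefl M0.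
  split.
    apply: (@lin_plogs_holder _ 2 _ L u _ m2 L2 eu _ M') => //; try lra.
    move=> x x01; rewrite e3 eQ' derivC addr0 -mul_polyC -polyCM.
    by rewrite (_ : 1 - 2 * s - 1 = - 2 * s); [exact: hM'|ring].
  move=> [e /= [e0 _] he].
  have [N hN] := @lin_plogs_holder_bound _ 2 _ L u isT m2 L2 eu _ he.
  (* The margin [1 - s] is half of the gap [2 - 2 s] between the leading exponent and the other
     ones; the other half absorbs logarithms. *)
  have [K [_ hK]] := rest 2%N (1 - 2 * s + (1 - s)) ltac:(lra).
  apply: (@const_lead_absurd _ (1 - 2 * s) ((2 - 2 * s) * b) (1 - s) e K N
    (plogs (iter 2 dplogs l))) => //; try lra.
    by rewrite mulf_neq0 // gt_eqF.
  by move=> x xh; rewrite -eQ' -e2; exact: hN.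
- move=> sh; have eB := Beq sh.
  have L1 : all (fun q : R * {poly R} => 2 <= q.1) L.
    rewrite all_cat /= andbT; apply/andP; split; last lra.
    by apply: sub_all hl => q; apply: le_trans; lra.
  have m1 : 1%:R < 2 :> R by lra.
  split.
    move=> e /= [e0 /andP[e1' _]].
    have [M [_ hM]] := @plogs_bound _ (- e) (iter 2 dplogs L) ltac:(
      apply: exponent_lt (iter_dplogs_exponent 2 L1); lra).
    apply: (@lin_plogs_holder _ 1 _ L u _ m1 L1 eu _ M) => //; try lra.
    by move=> x x01; rewrite (_ : 1 - e - 1 = - e); [exact: hM|ring].
  move=> he; have [N hN] := @lin_plogs_holder_bound _ 1 _ L u isT m1 L1 eu _ he.
  have [K [_ hK]] := rest 1%N 1 ltac:(lra).
  apply: (@log_lead_absurd _ (fraclap_const s) K N (plogs (iter 1 dplogs l))) => //.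
  move=> x xh; rewrite -eB (_ : plog 1 B x = plog (2 - 2 * s) B x).
    by rewrite -e1; exact: hN.
  by congr (plog _ _ _); lra.
- move=> sh; have [b b0 eb] : exists2 b : R, b != 0 & B = b%:P by apply: Bne; rewrite gt_eqF.
  have eQ' := Qc _ eb.
  have L1 : all (fun q : R * {poly R} => Num.min (3 - 2 * s) (5 - 4 * s) <= q.1) L.
    rewrite all_cat /= ge_min lexx /= andbT; apply: sub_all hl => q; apply: le_trans.
    by rewrite ge_min lexx orbT.
  have m1 : 1%:R < Num.min (3 - 2 * s) (5 - 4 * s).
    by rewrite lt_min; apply/andP; split; lra.
  have [M [M0 hM]] := rest 2%N (1 - 2 * s) ltac:(lra).
  have [M' hM'] := const (1 - 2 * s) ((2 - 2 * s) * b) (1 - 2 * s) M erefl M0.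
  split.
    apply: (@lin_plogs_holder _ 1 _ L u _ m1 L1 eu _ M') => //; try lra.
    move=> x x01; rewrite e2 eQ'.
    by rewrite (_ : 2 - 2 * s - 1 = 1 - 2 * s); [exact: hM'|ring].
  move=> [e /= [e0 _] he].
  have [N hN] := @lin_plogs_holder_bound _ 1 _ L u isT m1 L1 eu _ he.
  have [K [_ hK]] := rest 1%N (2 - 2 * s + (1 - s)) ltac:(lra).
  apply: (@const_lead_absurd _ (2 - 2 * s) b (1 - s) e K N
    (plogs (iter 1 dplogs l))) => //; try lra.
  by move=> x xh; rewrite -eb -e1; exact: hN.
Qed.
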